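(* Let $\pi$ be a generic irreducible admissible unitarizable representation of $G=\operatorname{GL}_2(F)$, let $n=a(\pi)$ and $m=a(\omega_\pi)$, and let $W_\pi$ be its normalized Whittaker newform. Put $h(\pi)=\sup_{g\in G}|W_\pi(g)|$. Then $$\max\left(q^{\frac12 \lfloor \frac{3m}{2} \rfloor - \frac{n}2},\, 1\right) \ll h(\pi) \ll q^{\frac12 \lfloor \frac{n}{2} \rfloor},$$ where the implied constants are absolute.
   Context: $F$ is a non-archimedean local field of characteristic $0$ with ring of integers $\mathfrak o$, maximal ideal $\mathfrak p$, uniformizer $\varpi$, and residue field of cardinality $q$. Fix an additive character $\psi:F\to\mathbb C^1$ with conductor $\mathfrak o$ (trivial on $\mathfrak o$, nontrivial on $\mathfrak p^{-1}$). For a character $\chi$ of $F^\times$, $a(\chi)$ is the least nonnegative integer $a$ with $\chi(1+\mathfrak p^a)=1$ (where $1+\mathfrak p^0$ means $\mathfrak o^\times$). For $n\ge0$ let $K_1(\mathfrak p^n)=\{\begin{bmatrix}a&b\\c&d\end{bmatrix}\in\operatorname{GL}_2(\mathfrak o): a\in 1+\mathfrak p^n,\ c\in\mathfrak p^n\}$. For an irreducible admissible representation $\sigma$ of $G$, $a(\sigma)$ is the least $n\ge 0$ such that $\sigma$ has a nonzero $K_1(\mathfrak p^n)$-fixed vector, and $\omega_\sigma$ denotes its central character. For generic $\pi$, $\mathcal W(\pi,\psi)$ is its Whittaker model with respect to $\psi$, and the normalized Whittaker newform $W_\pi$ is the unique $K_1(\mathfrak p^{a(\pi)})$-invariant vector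 in $\mathcal W(\pi,\psi)$ with $W_\pi(1)=1$. *)

(* Defs.v *)
From HB Require Import structures.
From mathcomp Require Import all_boot all_order all_algebra.
From mathcomp Require Import sesquilinear complex.
From mathcomp Require Import all_classical all_reals all_analysis.

Set Implicit Arguments.
Unset Strict Implicit.
Unset Printing Implicit Defensive.

Import Order.TTheory GRing.Theory Num.Theory.

Local Open Scope classical_set_scope.
Local Open Scope ring_scope.

Definition is_least (P : nat -> Prop) (n : nat) : Prop :=
  P n /\ forall k : nat, P k -> (n <= k)%N.

(* [v] is the normalized valuation on the nonzero elements; [v 0] is junk and
   is never used, because [0] is put in every [pow_ideal v k] by hand. *)
Definition pow_ideal (F : fieldType) (v : F -> int) (k : int) : set F :=
  [set x | x != 0 -> k <= v x].

Record is_local_field (F : fieldType) (v : F -> int) (q : nat) : Prop := {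
  lf_pchar0 : [pchar F] =i pred0;
  lf_valM : forall x y : F, x != 0 -> y != 0 -> v (x * y) = v x + v y;
  lf_valD : forall x y : F, x != 0 -> y != 0 -> x + y != 0 ->
    Num.min (v x) (v y) <= v (x + y);
  lf_normalized : exists2 x : F, x != 0 & v x = 1;
  lf_complete : forall u : nat -> F,
    (forall k : int, exists N : nat, forall i j : nat,
       (N <= i)%N -> (N <= j)%N -> pow_ideal v k (u i - u j)) ->
    exists l : F, forall k : int, exists N : nat, forall i : nat,
      (N <= i)%N -> pow_ideal v k (u i - l);
  (* the cosets [x + p], for [x] in [o] *)
  lf_residue :
    ([set [set y | pow_ideal v 1 (y - x)] | x in pow_ideal v 0] #= `I_q)%card
}.

(* Non-archimedean local fields of characteristic 0. *)
Record localField := LocalField {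
  lf_sort :> fieldType;
  lf_val : lf_sort -> int;
  residue_card : nat;
  lf_axioms : is_local_field lf_val residue_card
}.

Definition pideal (F : localField) (k : int) : set F := pow_ideal (@lf_val F) k.

Definition ounit (F : localField) (x : F) : Prop :=
  x != 0 /\ lf_val x = 0.

(* For [a > 0] the first condition is implied by the second and this is
   [1 + p^a]; for [a = 0] the second is implied by the first and this is [o^*]. *)
Definition unit_filtration (F : localField) (a : nat) : set F :=
  [set x : F | ounit x /\ pideal a%:Z (x - 1)].

Section GL2Group.
Variable F : fieldType.

Record GL2 := MkGL2 { GL2val :> 'M[F]_2; GL2valP : GL2val \in unitmx }.

HB.instance Definition _ := [isSub for GL2val].
HB.instance Definition _ := [Choice of GL2 by <:].

Definition GL2_one : GL2 := MkGL2 (unitmx1 F 2).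

Fact GL2_mul_subproof (g h : GL2) : GL2val g *m GL2val h \in unitmx.
Proof. by rewrite unitmx_mul (GL2valP g) (GL2valP h). Qed.
Definition GL2_mul (g h : GL2) : GL2 := MkGL2 (GL2_mul_subproof g h).

Fact GL2_inv_subproof (g : GL2) : invmx (GL2val g) \in unitmx.
Proof. by rewrite unitmx_inv (GL2valP g). Qed.
Definition GL2_inv (g : GL2) : GL2 := MkGL2 (GL2_inv_subproof g).

Fact GL2_mulA : associative GL2_mul.
Proof. by move=> f g h; apply: val_inj; rewrite /= mulmxA. Qed.
Fact GL2_mul1 : left_id GL2_one GL2_mul.
Proof. by move=> g; apply: val_inj; rewrite /= mul1mx. Qed.
Fact GL2_mulV : left_inverse GL2_one GL2_inv GL2_mul.
Proof. by move=> g; apply: val_inj; rewrite /= mulVmx// (GL2valP g). Qed.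
Fact GL2_mulr1 : right_id GL2_one GL2_mul.
Proof. by move=> g; apply: val_inj; rewrite /= mulmx1. Qed.
Fact GL2_mulrV : right_inverse GL2_one GL2_inv GL2_mul.
Proof. by move=> g; apply: val_inj; rewrite /= mulmxV// (GL2valP g). Qed.

HB.instance Definition _ :=
  isGroup.Build GL2 GL2_mulA GL2_mul1 GL2_mulr1 GL2_mulV GL2_mulrV.

Fact unipotent_subproof (x : F) : 1%:M + x *: delta_mx 0 1 \in @unitmx F 2.
Proof.
rewrite -unitmx_tr unitmxE det_trig.
  by rewrite !big_ord_recl big_ord0 !mxE /= !mulr0 !addr0 !mulr1 unitr1.
apply/is_trig_mxP => i j ij; rewrite !mxE.
by case: i j ij => [[|[]]//= ?] [[|[]]//= ?] _; rewrite mulr0 addr0.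
Qed.
Definition unipotent (x : F) : GL2 := MkGL2 (unipotent_subproof x).

End GL2Group.

Section Subgroups.
Variable F : localField.

Definition GL2o : set (GL2 F) :=
  [set g : GL2 F | (forall i j, pideal 0 (g i j)) /\ ounit (\det g)].

Definition K1 (n : nat) : set (GL2 F) :=
  [set g : GL2 F | [/\ GL2o g, pideal n%:Z (g 0 0 - 1) & pideal n%:Z (g 1 0)]].

(* These form a neighbourhood basis of 1 in GL_2(F). *)
Definition principal_congruence (k : nat) : set (GL2 F) :=
  [set g : GL2 F | GL2o g /\ forall i j, pideal k%:Z ((GL2val g - 1%:M) i j)].

Definition open_subgroup (U : set (GL2 F)) : Prop :=
  [/\ U 1%g, (forall g h, U g -> U h -> U (g * h)%g),
      (forall g, U g -> U (g^-1)%g) &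
      exists k : nat, principal_congruence k `<=` U].

End Subgroups.

Section Representations.
Variables (R : realType) (F : localField) (V : lmodType R[i]).
Variable pi : GL2 F -> {linear V -> V}.

Definition is_representation : Prop :=
  (forall v, pi 1%g v = v) /\ (forall g h v, pi (g * h)%g v = pi g (pi h v)).

Definition is_subspace (S : set V) : Prop :=
  S 0 /\ forall (a : R[i]) (u v : V), S u -> S v -> S (a *: u + v).

Definition irreducible_rep : Prop :=
  (exists v : V, v != 0) /\
  forall S : set V, is_subspace S -> (forall g v, S v -> S (pi g v)) ->
    S = [set 0] \/ S = setT.

Definition fixed_space (U : set (GL2 F)) : set V :=
  [set v : V | forall g, U g -> pi g v = v].

Definition finite_dim (S : set V) : Prop :=
  exists (d : nat) (e : 'I_d -> V), forall v, S v ->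
    exists c : 'I_d -> R[i], v = \sum_(i < d) c i *: e i.

Definition admissible : Prop :=
  (forall v : V, open_subgroup [set g : GL2 F | pi g v = v]) /\
  (forall U : set (GL2 F), open_subgroup U -> finite_dim (fixed_space U)).

Definition unitarizable : Prop :=
  exists H : {dot V for (@Num.conj R[i])},
    forall g u v, H (pi g u) (pi g v) = H u v.

Definition central_character (omega : F -> R[i]) : Prop :=
  forall (g : GL2 F) (z : F), GL2val g = z%:M -> forall v, pi g v = omega z *: v.

Definition rep_conductor (n : nat) : Prop :=
  is_least (fun k => exists2 v : V, v != 0 & fixed_space (K1 k) v) n.

(* The Whittaker model is a realization of [pi] by right translation on a space
   [Wh] of functions with [W (n(x) g) = psi x * W g]. *)
Definition whittaker_model (psi : F -> R[i]) (Wh : set (GL2 F -> R[i])) : Prop :=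
  exists T : V -> (GL2 F -> R[i]),
  [/\ (forall (a : R[i]) (u v : V) g, T (a *: u + v) g = a * T u g + T v g),
      injective T,
      (forall h v g, T (pi h v) g = T v (g * h)%g),
      (forall v x g, T v (unipotent x * g)%g = psi x * T v g) &
      Wh = range T].

Definition generic (psi : F -> R[i]) : Prop :=
  exists Wh : set (GL2 F -> R[i]), whittaker_model psi Wh.

End Representations.

Section Characters.
Variables (R : realType) (F : localField).

(* Continuity of [psi] follows from its triviality on [o]. *)
Definition additive_character_conductor_o (psi : F -> R[i]) : Prop :=
  [/\ (forall x y, psi (x + y) = psi x * psi y),
      (forall x, `|psi x| = 1),
      (forall x, pideal 0 x -> psi x = 1) &
      exists2 x, pideal (- 1) x & psi x != 1].

Definition char_conductor (chi : F -> R[i]) (m : nat) : Prop :=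
  is_least (fun a => forall x, unit_filtration a x -> chi x = 1) m.

Definition normalized_newform (Wh : set (GL2 F -> R[i])) (n : nat)
    (W : GL2 F -> R[i]) : Prop :=
  [/\ Wh W, (forall k g, K1 n k -> W (g * k)%g = W g) & W 1%g = 1].

Definition sup_norm (W : GL2 F -> R[i]) : \bar R :=
  ereal_sup (range (fun g => (ComplexField.Normc.normc (W g))%:E)).

End Characters.

(* Main.v *)
(* The vectors whose Kirillov function is a multiple of the indicator of
   1 + p^k form a space on which the compressed operators E pi(g) E commute
   (Gelfand's trick for the anti-involution [a b; c d] |-> [d b; c a]); by
   Schur's lemma this space is a line.  Hence the spectral projections of
   n(p^(-J)) applied to a vector v are governed by the values W_v(a(y)), and the
   invariant inner product is the L^2 norm of y |-> W_v(a(y)) on every part of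
   F^* bounded away from 0.  For a newform this norm is comparable to |W(1)|^2:
   the contribution of p is controlled by the Hecke operator U, which either
   lowers the level or has U^* U = q.

   Upper bound (n > 0): up to modulus, W(g) is W(a(y) [1 0; c 1]) with c in o,
   and |W(a(y) [1 0; c 1])| is invariant under y -> y u for u in 1 + p^j, with
   some j <= n / 2; so q^(-j) |W(g)|^2 is at most the norm of W.  For n = 0 the
   Hecke recursion compares W(a(p^t)) with a matrix coefficient, which is
   bounded by Cauchy-Schwarz.

   Lower bound: if v(c) = ceil(n / 2) < m, ramification of omega forces
   y |-> W(a(y) [1 0; c 1]) to be supported on a coset b + o with
   v(b) = ceil(n / 2) - m, whose multiplicative measure is about
   q^(ceil(n / 2) - m); so |W|^2 is at least a constant times
   q^(m - ceil(n / 2)) somewhere on it. *)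
Require Import Defs.
From mathcomp Require Import all_boot all_order all_algebra.
From mathcomp Require Import sesquilinear complex.
From mathcomp Require Import all_classical all_reals all_analysis.
From mathcomp Require Import zify ring lra.

From HB Require Import structures.
Set Implicit Arguments.
Unset Strict Implicit.
Unset Printing Implicit Defensive.

Import Order.TTheory GRing.Theory Num.Theory.

Local Open Scope classical_set_scope.
Local Open Scope ring_scope.

(** Neither a space of functions on the multiplicative group nor an L^2 inner product is ever
    constructed. Only a local trace of the Kirillov model is used: the projection of v to the ball y
    (1 + p^k) has norm |W_v(a(y))|^2 H(xi, xi), with one fixed bump vector xi for all y and v. The
    depth k is auxiliary: it is so large that omega and the vectors at hand are invariant under 1 +
    p^k, and both q^k and H(xi, xi) cancel from the final estimates. Bessel's inequality holds for
    every vector. The obstacle is to bound the norm of the newform from above, since p contains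
    infinitely many such balls; this is why its part on p is estimated as a whole, by half of the
    norm. In the lower bound the translate meets only finitely many balls, so a finite Parseval
    identity suffices. The squares satisfy |W|^2 <= 4 q^floor(n/2) everywhere for n > 0, and 2 sup
    |W|^2 >= q^(m - ceil(n/2)) when ceil(n/2) < m. As m <= n, one has floor(m/2) <= floor(n/2), that
    is floor(3m/2) - n <= m - ceil(n/2), which gives the exponent of the statement. *)

(** * Valuation, fractional ideals, finite systems of representatives *)

Section LocalField.
Variable F : localField.
Implicit Types (x y z u : F) (J K L : int).

Let Fax := lf_axioms F.
Local Notation v := (@lf_val F).
Local Notation q := (residue_card F).

Lemma pidealE J x : x != 0 -> pideal J x <-> J <= v x.
Proof. by move=> x0; split=> [|h _]; [apply|]. Qed.

Lemma lf_valM_neq0 x y : x != 0 -> y != 0 -> v (x * y) = v x + v y.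
Proof. exact: (lf_valM Fax). Qed.

Lemma lf_val1 : v 1 = 0.
Proof.
by have := lf_valM_neq0 (oner_neq0 F) (oner_neq0 F); rewrite mulr1; set a := v 1; lia.
Qed.

Lemma lf_valV x : x != 0 -> v x^-1 = - v x.
Proof.
move=> x0; have := lf_valM_neq0 x0 (invr_neq0 x0).
by rewrite divff// lf_val1; lia.
Qed.

Lemma lf_valN1 : v (-1) = 0.
Proof.
have n1 : (-1 : F) != 0 by rewrite oppr_eq0 oner_neq0.
by have := lf_valM_neq0 n1 n1; rewrite mulrNN mulr1 lf_val1; lia.
Qed.

Lemma lf_valN x : v (- x) = v x.
Proof.
have [->|x0] := eqVneq x 0; first by rewrite oppr0.
by rewrite -mulN1r lf_valM_neq0 ?oppr_eq0 ?oner_neq0// lf_valN1 add0r.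
Qed.

Lemma pideal0 J : pideal J (0 : F).
Proof. by rewrite /pideal /pow_ideal /= eqxx. Qed.

Lemma pidealN J x : pideal J x -> pideal J (- x).
Proof. by rewrite /pideal /pow_ideal /= oppr_eq0 lf_valN. Qed.

Lemma pidealD J x y : pideal J x -> pideal J y -> pideal J (x + y).
Proof.
have [->|x0] := eqVneq x 0; first by rewrite add0r.
have [->|y0] := eqVneq y 0; first by rewrite addr0.
rewrite !(pidealE _ x0, pidealE _ y0) => hx hy xy0.
by apply: le_trans (lf_valD Fax x0 y0 xy0); rewrite le_min hx.
Qed.

Lemma pidealB J x y : pideal J x -> pideal J y -> pideal J (x - y).
Proof. by move=> hx hy; apply: pidealD => //; apply: pidealN. Qed.

Lemma pidealBC J x y : pideal J (x - y) -> pideal J (y - x).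
Proof. by move=> /pidealN; rewrite opprB. Qed.

Lemma pidealW J K x : K <= J -> pideal J x -> pideal K x.
Proof. by move=> KJ hx x0; apply: le_trans KJ (hx x0). Qed.

Lemma pidealM J K x y : pideal J x -> pideal K y -> pideal (J + K) (x * y).
Proof.
have [->|x0] := eqVneq x 0; first by rewrite mul0r => *; apply: pideal0.
have [->|y0] := eqVneq y 0; first by rewrite mulr0 => *; apply: pideal0.
move=> hx hy _; rewrite lf_valM_neq0//; apply: lerD; [exact: hx|exact: hy].
Qed.

Lemma pidealMl J x y : pideal 0 x -> pideal J y -> pideal J (x * y).
Proof. by move=> hx hy; rewrite -[J]add0r; apply: pidealM. Qed.

Lemma pidealMr J x y : pideal J x -> pideal 0 y -> pideal J (x * y).
Proof. by move=> hx hy; rewrite -[J]addr0; apply: pidealM. Qed.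

Lemma pideal_mul J K x y : x != 0 -> v x = K ->
  pideal (K + J) (x * y) <-> pideal J y.
Proof.
move=> x0 vx; split=> [h y0|h]; last by apply: pidealM => // _; rewrite vx.
by have := h (mulf_neq0 x0 y0); rewrite lf_valM_neq0// vx lerD2l.
Qed.

Lemma pideal_val x : pideal (v x) x.
Proof. by []. Qed.

Lemma pidealNP J x : ~ pideal J x -> x != 0 /\ v x < J.
Proof.
have [->|x0] := eqVneq x 0; first by case; apply: pideal0.
by rewrite pidealE// => /negP; rewrite -ltNge.
Qed.

Lemma pideal1 : pideal 0 (1 : F).
Proof. by move=> _; rewrite lf_val1. Qed.

Lemma ounit_pideal x : ounit x -> pideal 0 x.
Proof. by case=> x0 hx _; rewrite hx. Qed.

Lemma ounit1 : ounit (1 : F).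
Proof. by split; rewrite ?oner_neq0 ?lf_val1. Qed.

Lemma ounitM x y : ounit x -> ounit y -> ounit (x * y).
Proof.
by move=> [x0 hx] [y0 hy]; split; rewrite ?mulf_neq0// lf_valM_neq0// hx hy.
Qed.

Lemma ounitV x : ounit x -> ounit x^-1.
Proof. by move=> [x0 hx]; split; rewrite ?invr_neq0// lf_valV// hx. Qed.

Lemma ounitN x : ounit x -> ounit (- x).
Proof. by move=> [x0 hx]; split; rewrite ?oppr_eq0// lf_valN. Qed.

Lemma ounitP x : pideal 0 x -> ~ pideal 1 x -> ounit x.
Proof.
move=> h0 /pidealNP[x0 h1]; split=> //.
by move: h0; rewrite pidealE//; lia.
Qed.

Lemma ounit_pidealN x : ounit x -> ~ pideal 1 x.
Proof. by move=> [x0 hx]; rewrite pidealE// hx. Qed.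

Lemma ounitD x y : ounit x -> pideal 1 y -> ounit (x + y).
Proof.
move=> ux hy; apply: ounitP.
  by apply: pidealD (ounit_pideal ux) _; apply: pidealW hy.
move=> h; apply: (ounit_pidealN ux).
by rewrite -(addrK y x); apply: pidealB.
Qed.

Lemma ufiltP (a : nat) z : (0 < a)%N -> pideal a%:Z z ->
  unit_filtration a (1 + z).
Proof.
move=> a0 hz; split; last by rewrite addrC addKr.
by apply: ounitD ounit1 _; apply: pidealW hz; lia.
Qed.

Lemma ufiltV a x : unit_filtration a x -> unit_filtration a x^-1.
Proof.
move=> [ux hx]; split; first exact: ounitV.
have -> : x^-1 - 1 = - (x^-1 * (x - 1)).
  by rewrite mulrBr mulVf ?(proj1 ux)// mulr1 opprB.
by apply: pidealN; apply: pidealMl => //; apply/ounit_pideal/ounitV.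
Qed.

Lemma ufiltW a b x : (b <= a)%N -> unit_filtration a x -> unit_filtration b x.
Proof. by move=> ba [ux hx]; split=> //; apply: pidealW hx; lia. Qed.

Lemma ufilt_neq0 a x : unit_filtration a x -> x != 0.
Proof. by case; case. Qed.

Lemma exists_val J : exists2 x : F, x != 0 & v x = J.
Proof.
have [w w0 vw] := lf_normalized Fax.
have nat_val n : w ^+ n != 0 /\ v (w ^+ n) = n%:Z.
  elim: n => [|n [h0 hv]]; first by rewrite expr0 oner_neq0 lf_val1.
  by rewrite exprS mulf_neq0// lf_valM_neq0// vw hv; split=> //; lia.
case: J => n; have [h0 hv] := nat_val n.
  by exists (w ^+ n).
have [h0' hv'] := nat_val n.+1.
by exists (w ^+ n.+1)^-1; rewrite ?invr_neq0// lf_valV// hv' NegzE.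
Qed.

(** A complete irredundant system for p^J / p^L, kept as a list: finite sums over it take the place
    of Haar integrals. *)
Definition is_reps J L (s : seq F) : Prop :=
  [/\ uniq s, forall x, x \in s -> pideal J x,
      forall x, pideal J x -> exists2 y, y \in s & pideal L (x - y) &
      forall x y, x \in s -> y \in s -> pideal L (x - y) -> x = y].

Lemma digits_exist : exists2 D : seq F, size D = q & is_reps 0 1 D.
Proof.
have := lf_residue Fax.
set C := [set _ | x in _] => CI.
have /card_set_bijP[f [fC fI fS]] := CI.
have repP i : exists x : F, forall (Hi : (i < q)%N),
    pideal 0 x /\ f [set y | pow_ideal v 1 (y - x)] = i.
  have [Hi|Hi] := boolP (i < q)%N; last by exists 0.
  have [_ [x hx <-] <-] := fS i Hi.
  by exists x.
have [r rP] := choice repP.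
have rI i j : (i < q)%N -> (j < q)%N -> pideal 1 (r i - r j) -> i = j.
  move=> Hi Hj hij; rewrite -(rP i Hi).2 -(rP j Hj).2; congr f.
  apply/seteqP; split=> y /= hy.
    by rewrite -(subrK (r i) y) -addrA; apply: pidealD.
  rewrite -(subrK (r j) y) -addrA; apply: pidealD => //.
  exact: pidealBC.
exists (map r (iota 0 q)); first by rewrite size_map size_iota.
split.
- rewrite map_inj_in_uniq ?iota_uniq// => i j.
  rewrite !mem_iota !add0n => Hi Hj e; apply: rI => //.
  by rewrite e subrr; apply: pideal0.
- move=> x /mapP[a]; rewrite mem_iota add0n => Hi ->.
  exact: (rP a Hi).1.
- move=> x hx.
  pose c := [set y | pow_ideal v 1 (y - x)].
  have Cc : C c by exists x.
  have Hi : (f c < q)%N by apply: fC.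
  exists (r (f c)); first by apply/mapP; exists (f c); rewrite // mem_iota.
  have : [set y | pow_ideal v 1 (y - r (f c))] = c.
    apply: fI; rewrite ?inE//; last exact: (rP _ Hi).2.
    by exists (r (f c)) => //; exact: (rP _ Hi).1.
  move=> /seteqP[_ h]; apply: (h x); rewrite /c /mkset subrr.
  exact: pideal0.
- move=> x y /mapP[a]; rewrite mem_iota add0n => Hi ->.
  move=> /mapP[j]; rewrite mem_iota add0n => Hj -> h.
  by rewrite (rI _ _ Hi Hj h).
Qed.

Lemma residue_card_gt1 : (1 < q)%N.
Proof.
have [D sD [uD _ cD _]] := digits_exist.
have [a aD ha] := cD 0 (pideal0 0).
have [b bD hb] := cD 1 pideal1.
have ab : a != b.
  apply/eqP => ab; rewrite -ab in hb.
  apply: (ounit_pidealN ounit1).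
  have -> : (1 : F) = (1 - a) - (0 - a) by ring.
  exact: pidealB.
rewrite -sD; have : uniq [:: a; b] by rewrite /= inE ab.
move/uniq_leq_size => /(_ D); apply => z.
by rewrite !inE => /orP[] /eqP->.
Qed.

Lemma reps_cat J K L s s' : J <= K -> K <= L -> is_reps J K s ->
  is_reps K L s' -> is_reps J L [seq x + y | x <- s, y <- s'].
Proof.
move=> JK KL [us sJ sc si] [us' sJ' sc' si'].
have inj x y x' y' : x \in s -> y \in s' -> x' \in s -> y' \in s' ->
    pideal L (x + y - (x' + y')) -> x = x' /\ y = y'.
  move=> xs ys xs' ys' h.
  have xx' : x = x'.
    apply: si => //.
    have -> : x - x' = (x + y - (x' + y')) - (y - y') by ring.
    by apply: pidealB; [apply: pidealW h|apply: pidealB; apply: sJ'].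
  split=> //; apply: si' => //; move: h; rewrite xx'.
  by have -> : x' + y - (x' + y') = y - y' by ring.
split.
- apply: allpairs_uniq => // -[x y] [x' y'] /allpairsP[[a b] /= [as_ bs [-> ->]]].
  move=> /allpairsP[[a' b'] /= [as' bs' [-> ->]]] e.
  have [] := inj a b a' b' as_ bs as' bs'; first by rewrite e subrr; apply: pideal0.
  by move=> -> ->.
- move=> _ /allpairsP[[x y] /= [xs ys ->]]; apply: pidealD; first exact: sJ.
  by apply: pidealW (sJ' _ ys).
- move=> x hx; have [a as_ ha] := sc _ hx; have [b bs hb] := sc' _ ha.
  exists (a + b); first by apply/allpairsP; exists (a, b).
  by rewrite opprD addrA.
- move=> _ _ /allpairsP[[x y] /= [xs ys ->]] /allpairsP[[x' y'] /= [xs' ys' ->]].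
  by move=> h; have [-> ->] := inj _ _ _ _ xs ys xs' ys' h.
Qed.

Lemma reps_scale c J L s : c != 0 -> is_reps J L s ->
  is_reps (v c + J) (v c + L) [seq c * x | x <- s].
Proof.
move=> c0 [us sJ sc si]; split.
- by rewrite map_inj_uniq//; apply: mulfI.
- by move=> _ /mapP[x xs ->]; apply/pideal_mul => //; apply: sJ.
- move=> x hx; have : pideal J (c^-1 * x).
    by apply/(pideal_mul _ _ c0 erefl); rewrite mulVKf.
  move=> /sc[y ys hy]; exists (c * y); first exact: map_f.
  by rewrite -(mulVKf c0 x) -mulrBr; apply/pideal_mul.
- move=> _ _ /mapP[x xs ->] /mapP[y ys ->]; rewrite -mulrBr => h.
  by rewrite (si x y)//; apply/(pideal_mul _ _ c0 erefl).
Qed.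

Lemma reps_exist J n :
  exists2 s : seq F, size s = (q ^ n)%N & is_reps J (J + n%:Z) s.
Proof.
elim: n J => [|n IH] J.
  exists [:: 0] => //; split=> //.
  - by move=> x; rewrite inE => /eqP->; apply: pideal0.
  - move=> x hx; exists 0; first by rewrite inE.
    by rewrite (subr0 x); apply: pidealW hx; lia.
  - by move=> x y; rewrite !inE => /eqP-> /eqP->.
have [D sD rD] := digits_exist.
have [c c0 vc] := exists_val J.
have rD' := reps_scale c0 rD; rewrite vc addr0 in rD'.
have [s ss rs] := IH (J + 1).
exists [seq x + y | x <- [seq c * x | x <- D], y <- s].
  by rewrite size_allpairs size_map sD ss expnS.
have -> : J + n.+1%:Z = J + 1 + n%:Z by lia.
by apply: reps_cat rD' rs; lia.
Qed.

(* Everything is invariant under p^L, and [phi] induces an injection, hence a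
   bijection, between the two systems. *)
Lemma reps_sum (V : nmodType) J L J' L' s s' (phi : F -> F) (f : F -> V) :
  is_reps J L s -> is_reps J' L' s' -> size s = size s' ->
  (forall x, pideal J x -> pideal J' (phi x)) ->
  (forall x y, pideal J x -> pideal J y -> pideal L' (phi x - phi y) ->
    pideal L (x - y)) ->
  (forall x y, pideal J' x -> pideal J' y -> pideal L' (x - y) -> f x = f y) ->
  \sum_(x <- s) f (phi x) = \sum_(y <- s') f y.
Proof.
move=> [us sJ sc si] [us' sJ' sc' si'] ss' phiJ phiI fL.
pose rho x := xget 0 [set y | y \in s' /\ pideal L' (x - y)].
have rhoP x : pideal J' x -> rho x \in s' /\ pideal L' (x - rho x).
  by move=> hx; rewrite /rho; case: xgetP => [y _ //|];
     have [y ys hy] := sc' x hx => /(_ y) [].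
have e : \sum_(x <- s) f (phi x) = \sum_(y <- [seq rho (phi x) | x <- s]) f y.
  rewrite big_map !big_seq; apply: eq_bigr => x xs.
  have [h1 h2] := rhoP _ (phiJ _ (sJ _ xs)).
  by apply: fL => //; [apply: phiJ; apply: sJ|apply: sJ'].
rewrite e; apply: perm_big.
have um : uniq [seq rho (phi x) | x <- s].
  rewrite map_inj_in_uniq// => x y xs ys exy.
  apply: si => //; apply: phiI; try exact: sJ.
  have [_ hx] := rhoP _ (phiJ _ (sJ _ xs)).
  have [_ hy] := rhoP _ (phiJ _ (sJ _ ys)).
  rewrite -(subrK (rho (phi x)) (phi x)) -addrA; apply: pidealD => //.
  by rewrite exy; apply: pidealBC.
have sub : {subset [seq rho (phi x) | x <- s] <= s'}.
  by move=> _ /mapP[x xs ->]; case: (rhoP _ (phiJ _ (sJ _ xs))).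
have [|_ h] := uniq_min_size um sub; first by rewrite size_map ss'.
exact: uniq_perm.
Qed.

Definition reps J n : seq F :=
  xget [::] [set s | size s = (q ^ n)%N /\ is_reps J (J + n%:Z) s].

Lemma repsP J n : size (reps J n) = (q ^ n)%N /\ is_reps J (J + n%:Z) (reps J n).
Proof.
rewrite /reps; case: xgetP => [s _ //|].
by have [s h1 h2] := reps_exist J n => /(_ s) [].
Qed.

Lemma size_reps J n : size (reps J n) = (q ^ n)%N.
Proof. by case: (repsP J n). Qed.

Lemma reps_is J n : is_reps J (J + n%:Z) (reps J n).
Proof. by case: (repsP J n). Qed.

Lemma mem_reps J n x : x \in reps J n -> pideal J x.
Proof. by have [_ h _ _] := reps_is J n; apply: h. Qed.

Lemma reps_uniq J n : uniq (reps J n).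
Proof. by case: (reps_is J n). Qed.

End LocalField.

(** * Haar integrals of locally constant functions *)

Section Integral.
Variables (F : localField) (K : numFieldType) (V : lmodType K).
Implicit Types (x y z u : F) (J L : int) (n p : nat) (f g : F -> V).
Local Notation q := (residue_card F).

Definition lev f J L := forall x z, pideal J x -> pideal L z -> f (x + z) = f x.

Definition avg J n f : V := (q%:R ^+ n)^-1 *: \sum_(x <- reps F J n) f x.

Lemma qneq0 : q%:R != 0 :> K.
Proof. by rewrite pnatr_eq0; have := residue_card_gt1 F; lia. Qed.

Lemma levW f J L L' : L <= L' -> lev f J L -> lev f J L'.
Proof. by move=> LL' h x z hx hz; apply: h => //; apply: pidealW hz. Qed.

Lemma lev_eq f J L x y : lev f J L -> pideal J y -> pideal L (x - y) ->
  f x = f y.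
Proof. by move=> h hy hxy; rewrite -(h y (x - y))// addrC subrK. Qed.

Lemma avg_split J n p f : lev f J (J + (n + p)%:Z) ->
  avg J (n + p) f =
  (q%:R ^+ n)^-1 *: \sum_(r <- reps F J n) avg (J + n%:Z) p (fun z => f (r + z)).
Proof.
move=> lf; rewrite /avg -scaler_sumr scalerA exprD invfM; congr (_ *: _).
have rc : is_reps J (J + (n + p)%:Z)
    [seq x + y | x <- reps F J n, y <- reps F (J + n%:Z) p].
  apply: reps_cat (reps_is _ _ _) _; try lia.
  by have := reps_is F (J + n%:Z) p; rewrite -addrA.
rewrite (reps_sum (phi := id) (reps_is F J (n + p)) rc) ?size_allpairs//.
- by rewrite big_allpairs_dep.
- by rewrite !size_reps expnD.
- by move=> x y _ hy hxy; apply: lev_eq lf hy hxy.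
Qed.

Lemma avgS J n p f : lev f J (J + n%:Z) -> avg J (n + p) f = avg J n f.
Proof.
move=> lf; rewrite avg_split; last by apply: levW lf; lia.
congr (_ *: _); rewrite !big_seq; apply: eq_bigr => r /mem_reps hr.
rewrite /avg (eq_big_seq (fun=> f r)).
  rewrite big_const_seq count_predT size_reps iter_addr_0 -scaler_nat scalerA.
  by rewrite natrX mulVf ?scale1r// expf_eq0 negb_and qneq0 orbT.
by move=> z /mem_reps hz; apply: lf.
Qed.

Definition lc f J := exists n, lev f J (J + n%:Z).

(* The normalised Haar integral of a locally constant function over p^J. *)
Definition Int J f : V := locked (avg J (xget 0%N [set n | lev f J (J + n%:Z)]) f).

(** Refining a level does not change the average, so the arbitrary level picked by [xget] may be
    replaced by any valid one. *)
Lemma IntE J n f : lev f J (J + n%:Z) -> Int J f = avg J n f.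
Proof.
move=> lf; rewrite /Int -lock; case: xgetP => [m _ /= lm|/(_ n)//].
by have [mn|/ltnW mn] := leqP m n;
  rewrite -(subnKC mn) avgS// subnKC.
Qed.

(** The level picked by [xget] is itself determined by the values on p^J, so f and g get the same
    one, even when no level exists. *)
Lemma Int_eq J f g : (forall x, pideal J x -> f x = g x) -> Int J f = Int J g.
Proof.
move=> fg; have e n : avg J n f = avg J n g.
  by congr (_ *: _); rewrite !big_seq; apply: eq_bigr => x /mem_reps /fg.
rewrite /Int -!lock e; congr (avg J (xget _ _) g); apply/seteqP.
split=> n /= h x z hx hz.
  by rewrite -!fg//; [apply: h|apply: pidealD => //; apply: pidealW hz; lia].
by rewrite !fg//; [apply: h|apply: pidealD => //; apply: pidealW hz; lia].
Qed.

Lemma Int_cst J w : Int J (fun=> w) = w.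
Proof.
rewrite (@IntE J 0); last by [].
rewrite /avg big_const_seq count_predT size_reps iter_addr_0 expn0 expr0.
by rewrite invr1 scale1r mulr1n.
Qed.

Lemma lc_isom J J' f (phi : F -> F) : lc f J' ->
  (forall x, pideal J x -> pideal J' (phi x)) ->
  (forall n x y, pideal J x -> pideal J y ->
     pideal (J + n%:Z) (x - y) <-> pideal (J' + n%:Z) (phi x - phi y)) ->
  lc (fun x => f (phi x)) J.
Proof.
move=> [n lf] phiJ phiI; exists n => x z hx hz.
have hz' : pideal J z by apply: pidealW hz; lia.
apply: lev_eq lf _ _; first exact: phiJ.
apply/phiI => //; first exact: pidealD.
by have -> : x + z - x = z by ring.
Qed.

(** Change of variables for maps that scale distances by a constant factor. Such a map is injective
    on cosets at every level, hence bijective by counting. It serves for translations, for scalings,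
    and for multiplication and inversion on 1 + p^k. *)
Lemma Int_isom J J' f (phi : F -> F) : lc f J' ->
  (forall x, pideal J x -> pideal J' (phi x)) ->
  (forall n x y, pideal J x -> pideal J y ->
     pideal (J + n%:Z) (x - y) <-> pideal (J' + n%:Z) (phi x - phi y)) ->
  Int J (fun x => f (phi x)) = Int J' f.
Proof.
move=> lf phiJ phiI; have [m lm] := lc_isom lf phiJ phiI.
have [n {}lf] := lf.
have lf' : lev f J' (J' + (n + m)%:Z) by apply: levW lf; lia.
rewrite (IntE lf') (@IntE J (n + m)); last by apply: levW lm; lia.
congr (_ *: _); apply: reps_sum (reps_is _ _ _) (reps_is _ _ _) _ _ _ _ => //.
- by rewrite !size_reps.
- by move=> x y hx hy hxy; apply/phiI.
- by move=> x y _ hy hxy; apply: lev_eq lf' hy hxy.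
Qed.

Lemma Int_split J n f : lc f J ->
  Int J f =
  (q%:R ^+ n)^-1 *: \sum_(r <- reps F J n) Int (J + n%:Z) (fun z => f (r + z)).
Proof.
move=> [p lf]; have lf' : lev f J (J + (n + p)%:Z) by apply: levW lf; lia.
rewrite (IntE lf') avg_split//; congr (_ *: _).
rewrite !big_seq; apply: eq_bigr => r /mem_reps hr; rewrite (@IntE _ p)//.
move=> x z hx hz; rewrite (addrA r); apply: lf'.
  by apply: pidealD => //; apply: pidealW hx; lia.
by apply: pidealW hz; lia.
Qed.

Lemma Int_shift J f y : lc f J -> pideal J y ->
  Int J (fun x => f (y + x)) = Int J f.
Proof.
move=> lf hy; apply: (Int_isom (phi := fun x => y + x)) => //.
  by move=> x hx; apply: pidealD.
by move=> n x z _ _; rewrite opprD addrACA subrr add0r.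
Qed.

Lemma Int_scale J f c : c != 0 -> lc f (lf_val c + J) ->
  Int J (fun x => f (c * x)) = Int (lf_val c + J) f.
Proof.
move=> c0 lf; apply: (Int_isom (phi := fun x => c * x)) => //.
  by move=> x hx; apply/pideal_mul.
by move=> n x z _ _; rewrite -mulrBr -addrA; apply: iff_sym; apply: pideal_mul.
Qed.

(* The factor is the relative measure of p^(J+n). *)
Lemma Int_supp J n f : lc f J ->
  (forall x, pideal J x -> ~ pideal (J + n%:Z) x -> f x = 0) ->
  Int J f = (q%:R ^+ n)^-1 *: Int (J + n%:Z) f.
Proof.
move=> lf f0; rewrite (Int_split n lf); congr (_ *: _).
have [_ _ rc ri] := reps_is F J n.
have [r0 r0s hr0] := rc 0 (@pideal0 F J).
rewrite (bigD1_seq r0) ?reps_uniq//= big1_seq ?addr0.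
  rewrite Int_shift//; last by move/pidealN: hr0; rewrite sub0r opprK.
  case: lf => p lf; exists p => x z hx hz.
  by apply: lf; [apply: pidealW hx|apply: pidealW hz]; lia.
move=> r /andP[rr0 rs].
rewrite (Int_eq (g := fun=> 0)) ?Int_cst// => z hz.
apply: f0.
  by apply: pidealD (mem_reps rs) _; apply: pidealW hz; lia.
move=> hrz; move/eqP: rr0; apply; apply: ri => //.
have -> : r - r0 = (r + z) - z + (0 - r0) by ring.
by apply: pidealD => //; apply: pidealB.
Qed.

Lemma IntD J f g : lc f J -> lc g J ->
  Int J (fun x => f x + g x) = Int J f + Int J g.
Proof.
move=> [n lf] [p lg].
have lf' : lev f J (J + (n + p)%:Z) by apply: levW lf; lia.
have lg' : lev g J (J + (n + p)%:Z) by apply: levW lg; lia.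
rewrite (IntE lf') (IntE lg') (@IntE _ (n + p)).
  by rewrite /avg big_split scalerDr.
by move=> x z hx hz; rewrite lf'// lg'.
Qed.


Lemma lc_eq J f g : (forall x, pideal J x -> f x = g x) -> lc f J -> lc g J.
Proof.
move=> fg [n lf]; exists n => x z hx hz; rewrite -!fg//; first exact: lf.
by apply: pidealD => //; apply: pidealW hz; lia.
Qed.

Lemma lcZ J c f : lc f J -> lc (fun x => c *: f x) J.
Proof. by move=> [n lf]; exists n => x z hx hz; rewrite lf. Qed.

Lemma lcD J f g : lc f J -> lc g J -> lc (fun x => f x + g x) J.
Proof.
move=> [n lf] [p lg]; exists (n + p)%N => x z hx hz.
by rewrite lf ?lg//; apply: pidealW hz; lia.
Qed.

End Integral.

Lemma Int_linear (F : localField) (K : numFieldType) (V V' : lmodType K)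
    (phi : V -> V') (J : int) (f : F -> V) : linear phi -> lc f J ->
  Int J (fun x => phi (f x)) = phi (Int J f).
Proof.
move=> phiL [n lf].
have phi0 : phi 0 = 0.
  have := phiL 1 0 0; rewrite !scale1r addr0 => /(congr1 (fun w => w - phi 0)).
  by rewrite addrK subrr.
have phiD u v : phi (u + v) = phi u + phi v.
  by have := phiL 1 u v; rewrite !scale1r.
have phiZ c u : phi (c *: u) = c *: phi u.
  by have := phiL c u 0; rewrite phi0 !addr0.
rewrite (IntE lf) (@IntE _ _ _ J n).
  by rewrite /avg phiZ (big_morph phi phiD phi0).
by move=> x z hx hz; rewrite lf.
Qed.


Lemma IntZ (F : localField) (K : numFieldType) (V : lmodType K) (J : int)
    (c : K) (f : F -> V) : lc f J -> Int J (fun x => c *: f x) = c *: Int J f.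
Proof.
move=> lf; rewrite -(@Int_linear _ _ _ _ (fun w => c *: w))//.
by move=> b u w; rewrite scalerDr !scalerA mulrC.
Qed.

(** * Explicit 2 by 2 matrices *)

Section Matrices.
Variable F : fieldType.
Implicit Types a b c d : F.

Definition mx2 a b c d : 'M[F]_2 :=
  \matrix_(i, j) (if i == 0 then if j == 0 then a else b
                  else if j == 0 then c else d).

Lemma det_mx2 a b c d : \det (mx2 a b c d) = a * d - b * c.
Proof.
rewrite (expand_det_row _ 0) !big_ord_recl big_ord0 addr0 /cofactor !det_mx11.
by rewrite !mxE /= expr0 expr1 mul1r; ring.
Qed.

(* Junk value 1 when the determinant vanishes. *)
Definition G2 a b c d : GL2 F := insubd (1%g : GL2 F) (mx2 a b c d).

Lemma G2E a b c d : a * d - b * c != 0 -> GL2val (G2 a b c d) = mx2 a b c d.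
Proof. by move=> h; rewrite /G2 val_insubd unitmxE det_mx2 unitfE h. Qed.

Lemma mx2E (M : 'M[F]_2) : M = mx2 (M 0 0) (M 0 1) (M 1 0) (M 1 1).
Proof.
by apply/matrixP => i j; rewrite mxE; case: i => [[|[]]//= hi];
  case: j => [[|[]]//= hj]; congr (M _ _); apply: val_inj.
Qed.

Lemma mx2M a b c d a' b' c' d' : mx2 a b c d *m mx2 a' b' c' d' =
  mx2 (a * a' + b * c') (a * b' + b * d') (c * a' + d * c') (c * b' + d * d').
Proof.
by rewrite [LHS]mx2E !mxE !big_ord_recl !big_ord0 !mxE /= !addr0.
Qed.

Lemma G2M a b c d a' b' c' d' : a * d - b * c != 0 -> a' * d' - b' * c' != 0 ->
  (G2 a b c d * G2 a' b' c' d')%g =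
  G2 (a * a' + b * c') (a * b' + b * d') (c * a' + d * c') (c * b' + d * d').
Proof.
move=> h h'; apply: val_inj; rewrite /= !G2E ?mx2M//.
apply: contraNneq (mulf_neq0 h h') => e; rewrite -e; apply/eqP; ring.
Qed.

Lemma G2P (g : GL2 F) : exists a b c d,
  [/\ a * d - b * c != 0, g = G2 a b c d & GL2val g = mx2 a b c d].
Proof.
have gE := mx2E (GL2val g).
exists (g 0 0), (g 0 1), (g 1 0), (g 1 1).
have h : g 0 0 * g 1 1 - g 0 1 * g 1 0 != 0.
  by rewrite -det_mx2 -gE -unitfE -unitmxE (GL2valP g).
by split=> //; apply: val_inj; rewrite /= G2E.
Qed.

Lemma G21 : G2 1 0 0 1 = 1%g.
Proof.
apply: val_inj; rewrite /= G2E; last by rewrite mulr1 mulr0 subr0 oner_neq0.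
by rewrite [RHS]mx2E !mxE.
Qed.

Lemma unipotentE x : unipotent x = G2 1 x 0 1.
Proof.
apply: val_inj; rewrite /= G2E; last by rewrite mulr1 mulr0 subr0 oner_neq0.
by rewrite [LHS]mx2E !mxE /=; congr mx2; ring.
Qed.

Lemma scalar_G2 z : z != 0 -> GL2val (G2 z 0 0 z) = z%:M.
Proof.
move=> z0; rewrite G2E; last by rewrite mulr0 subr0 mulf_neq0.
by rewrite [RHS]mx2E !mxE.
Qed.

End Matrices.

(** The Whittaker model enters through the functional v |-> W_v(1), so that W_v(g) is
    [uw_ell (uw_pi g v)]; [uw_ell_inj] is the injectivity of v |-> W_v. *)
Record unitary_whittaker (R : realType) (F : localField) := UnitaryWhittaker {
  uw_psi : F -> R[i];
  uw_V : lmodType R[i];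
  uw_pi : GL2 F -> {linear uw_V -> uw_V};
  uw_omega : F -> R[i];
  uw_ell : uw_V -> R[i];
  uw_H : {dot uw_V for (@Num.conj R[i])};
  uw_psiP : additive_character_conductor_o uw_psi;
  uw_piP : is_representation uw_pi;
  uw_adm : admissible uw_pi;
  uw_irr : irreducible_rep uw_pi;
  uw_omegaP : central_character uw_pi uw_omega;
  uw_ellL : forall a u v, uw_ell (a *: u + v) = a * uw_ell u + uw_ell v;
  uw_ellN : forall x v, uw_ell (uw_pi (unipotent x) v) = uw_psi x * uw_ell v;
  uw_ell_inj : forall v, (forall g, uw_ell (uw_pi g v) = 0) -> v = 0;
  uw_inv : forall g u v, uw_H (uw_pi g u) (uw_pi g v) = uw_H u v
}.

(** * The additive character and the elementary operators *)

Section Basics.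
Variables (R : realType) (F : localField) (D : unitary_whittaker R F).
Local Notation psi := (uw_psi D).
Local Notation V := (uw_V D).
Local Notation pi := (@uw_pi _ _ D).
Local Notation omega := (uw_omega D).
Implicit Types (x y z t u a b c d : F) (J K L : int) (v w : V) (k n : nat).

Definition nn x := pi (G2 1 x 0 1).
Definition aa y := pi (G2 y 0 0 1).
Definition lw c := pi (G2 1 0 c 1).
Definition ww := pi (G2 0 1 1 0).

Lemma psiD x y : psi (x + y) = psi x * psi y.
Proof. by case: (uw_psiP D). Qed.

Lemma psi_norm x : `|psi x| = 1.
Proof. by case: (uw_psiP D). Qed.

Lemma psi_o x : pideal 0 x -> psi x = 1.
Proof. by case: (uw_psiP D) => _ _ h _; apply: h. Qed.

Lemma psi_neq0 x : psi x != 0.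
Proof. by rewrite -normr_eq0 psi_norm oner_neq0. Qed.

Lemma psi0 : psi 0 = 1.
Proof. exact/psi_o/pideal0. Qed.

Lemma psiN x : psi (- x) = (psi x)^-1.
Proof.
by apply: (mulIf (psi_neq0 x)); rewrite -psiD addNr psi0 mulVf ?psi_neq0.
Qed.

(** The annihilator of p^J under psi is exactly p^(-J): if v(x) < -J, an element of p^(-1) with
    nontrivial psi lands in p^J after division by x. *)
Lemma psi_dual J x : ~ pideal (- J) x -> exists2 b, pideal J b & psi (b * x) != 1.
Proof.
move=> /pidealNP[x0 vx]; case: (uw_psiP D) => _ _ po [y hy psy].
have y0 : y != 0 by apply: contraNneq psy => ->; rewrite psi0.
exists (y / x); last by rewrite divfK.
move=> _; rewrite lf_valM_neq0 ?invr_neq0// lf_valV//.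
have := hy y0; move: vx; lia.
Qed.

Lemma act1 v : pi (G2 1 0 0 1) v = v.
Proof. by rewrite G21; case: (uw_piP D). Qed.

Lemma actG g h v : pi (g * h)%g v = pi g (pi h v).
Proof. by case: (uw_piP D). Qed.

Lemma actM a b c d a' b' c' d' v : a * d - b * c != 0 -> a' * d' - b' * c' != 0 ->
  pi (G2 a b c d) (pi (G2 a' b' c' d') v) =
  pi (G2 (a * a' + b * c') (a * b' + b * d')
         (c * a' + d * c') (c * b' + d * d')) v.
Proof. by move=> h h'; rewrite -actG G2M. Qed.

Lemma act_scalar z v : z != 0 -> pi (G2 z 0 0 z) v = omega z *: v.
Proof. by move=> z0; exact: (@uw_omegaP _ _ D _ _ (scalar_G2 z0)). Qed.

Lemma act_eq a b c d a' b' c' d' v : a = a' -> b = b' -> c = c' -> d = d' ->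
  pi (G2 a b c d) v = pi (G2 a' b' c' d') v.
Proof. by move=> -> -> -> ->. Qed.

End Basics.

Arguments act_eq {R F D}.

Ltac nz := rewrite ?(mulr0, mul0r, mulr1, mul1r, subr0, sub0r, add0r, addr0,
  oppr_eq0) ?mulf_neq0 ?invr_neq0 ?expf_neq0
  ?oppr_eq0 ?oner_neq0 //.

Ltac mxact := rewrite /nn /aa /lw /ww ?actM; [apply: act_eq; field; nz | nz ..].

(** * Smoothness and spectral projections of the unipotent group *)

Section Translations.
Variables (R : realType) (F : localField) (D : unitary_whittaker R F).
Local Notation psi := (uw_psi D).
Local Notation V := (uw_V D).
Local Notation pi := (@uw_pi _ _ D).
Local Notation omega := (uw_omega D).
Local Notation q := (residue_card F).
Local Notation nn := (@nn _ _ D).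
Local Notation aa := (@aa _ _ D).
Local Notation lw := (@lw _ _ D).
Local Notation ww := (ww D).
Implicit Types (x y z t u a b c d : F) (J K L : int) (v w : V) (k n : nat).

Lemma nnD x y v : nn x (nn y v) = nn (x + y) v.
Proof. mxact. Qed.

Lemma nn0 v : nn 0 v = v.
Proof. exact: act1. Qed.

Lemma aaM x y v : x != 0 -> y != 0 -> aa x (aa y v) = aa (x * y) v.
Proof. move=> x0 y0; mxact. Qed.

Lemma aa1 v : aa 1 v = v.
Proof. exact: act1. Qed.

Lemma aaVK x v : x != 0 -> aa x^-1 (aa x v) = v.
Proof. by move=> x0; rewrite aaM ?invr_neq0// mulVf// aa1. Qed.

Lemma aa_nn y x v : y != 0 -> aa y (nn x v) = nn (y * x) (aa y v).
Proof. move=> y0; mxact. Qed.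

Lemma nn_aa y x v : y != 0 -> nn x (aa y v) = aa y (nn (x / y) v).
Proof. by move=> y0; rewrite aa_nn// mulrCA divff// mulr1. Qed.

Lemma lwD x y v : lw x (lw y v) = lw (x + y) v.
Proof. mxact. Qed.

Lemma lw0 v : lw 0 v = v.
Proof. exact: act1. Qed.

Lemma wwK v : ww (ww v) = v.
Proof. by rewrite -[RHS]act1; mxact. Qed.

Lemma omegaM y z : y != 0 -> z != 0 -> omega (y * z) = omega y * omega z.
Proof.
move=> y0 z0; have [[v v0] _] := uw_irr D.
apply/eqP; rewrite -subr_eq0; have := scaler_eq0 (omega (y * z) - omega y * omega z) v.
rewrite (negPf v0) orbF => <-; rewrite scalerBl subr_eq0 -scalerA.
rewrite -!act_scalar ?mulf_neq0//.
by apply/eqP; mxact.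
Qed.

Lemma smooth v : exists k : nat, (0 < k)%N /\ forall a b c d,
  pideal k%:Z (a - 1) -> pideal k%:Z b -> pideal k%:Z c -> pideal k%:Z (d - 1) ->
  pi (G2 a b c d) v = v.
Proof.
have [_ _ _ [k0 hk]] := (uw_adm D).1 v.
exists k0.+1; split=> // a b c d ha hb hc hd.
have le1 : (1 <= k0.+1%:Z)%R by lia.
have o x : pideal k0.+1%:Z (x - 1) -> ounit x.
  move=> hx; rewrite -(subrK 1 x) addrC; apply: ounitD; first exact: ounit1.
  exact: pidealW hx.
have ua := o _ ha; have ud := o _ hd.
have udet : ounit (a * d - b * c).
  apply: ounitD (ounitM ua ud) _; apply/pidealN/pidealMl; last exact: pidealW hc.
  by apply: pidealW hb.
have d0 : a * d - b * c != 0 by case: udet.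
apply: hk; split.
- split; last by rewrite G2E// det_mx2.
  have ob x : pideal k0.+1%:Z x -> pideal 0 x by apply: pidealW.
  move=> i j; rewrite G2E// mxE.
  by do 2!case: ifP => _; auto; apply: ounit_pideal.
- move=> i j; rewrite G2E// 2!mxE mxE.
  have W x : pideal k0.+1%:Z x -> pideal k0%:Z x by apply: pidealW; lia.
  case: i => [[|[]]//= ?]; case: j => [[|[]]//= ?];
    apply: W; rewrite mxE ?mulr1n ?mulr0n ?subr0//.
Qed.

Lemma smooth_nn v : exists L, forall x, pideal L x -> nn x v = v.
Proof.
have [k [_ hk]] := smooth v; exists k%:Z => x hx.
by apply: hk; rewrite ?subrr//; apply: pideal0.
Qed.

Lemma smooth_aa v : exists2 k, (0 < k)%N &
  forall u, unit_filtration k u -> aa u v = v.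
Proof.
have [k [k0 hk]] := smooth v; exists k => // u [_ hu].
by apply: hk; rewrite ?subrr//; apply: pideal0.
Qed.

Lemma psi_lev y : exists n, forall x, pideal n%:Z x -> psi (y * x) = 1.
Proof.
exists `|lf_val y|%N => x hx; apply: psi_o.
have -> : 0 = lf_val y + - lf_val y by rewrite subrr.
by apply: pidealM => //; apply: pidealW hx; lia.
Qed.

Lemma lc_nn J y v : lc (fun x => psi (- (y * x)) *: nn x v) J.
Proof.
have [L hL] := smooth_nn v; have [p hp] := psi_lev (- y).
exists (`|L|%N + p + `|J|%N)%N => x z hx hz.
rewrite mulrDr opprD psiD -mulNr -[- (y * z)]mulNr.
rewrite (hp z); last by apply: pidealW hz; lia.
by rewrite mulr1 -nnD hL//; apply: pidealW hz; lia.
Qed.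

Lemma lc_aa k v : (0 < k)%N -> lc (fun z => aa (1 + z) v) k%:Z.
Proof.
move=> k0; have [p p0 hp] := smooth_aa v.
exists p => x z hx hz.
have ux := ufiltP k0 hx; have x0 := ufilt_neq0 ux.
have -> : 1 + (x + z) = (1 + x) * (1 + z / (1 + x)).
  by rewrite mulrDr mulr1 mulrCA divff// mulr1 addrA.
have uz : unit_filtration p (1 + z / (1 + x)).
  apply: ufiltP => //; apply: pidealMr; first by apply: pidealW hz; lia.
  by apply: ounit_pideal; apply: ounitV; case: ux.
by rewrite -aaM// ?(ufilt_neq0 uz)// hp.
Qed.

(* The projection on the psi(y.)-eigenspace of n(p^(-J)); in the Kirillov model
   it is the restriction of functions to y + p^J. *)
Definition Pr J y v : V := Int (- J) (fun x => psi (- (y * x)) *: nn x v).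

Lemma Pr_linear J y : linear (Pr J y).
Proof.
move=> a u v; rewrite /Pr -IntZ; last exact: lc_nn.
rewrite -IntD; [|by apply: lcZ; exact: lc_nn|exact: lc_nn].
apply: Int_eq => x _; rewrite linearP scalerDr !scalerA.
by rewrite mulrC.
Qed.

HB.instance Definition _ (J : int) (y : F) :=
  GRing.isLinear.Build R[i] V V *:%R (Pr J y) (Pr_linear J y).

Lemma Pr_nnl J y x v : nn x (Pr J y v) = Pr J y (nn x v).
Proof.
rewrite /Pr -Int_linear; [|exact: linearP|exact: lc_nn].
by apply: Int_eq => z _; rewrite linearZ /= !nnD addrC.
Qed.

Lemma Pr_eigen J y x v : pideal (- J) x -> nn x (Pr J y v) = psi (y * x) *: Pr J y v.
Proof.
move=> hx; rewrite {1}/Pr -(Int_shift (y := - x)); [|exact: lc_nn|exact: pidealN].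
rewrite -Int_linear; [|exact: linearP|]; last first.
  have [n hn] := lc_nn (- J) y v; exists n => z z' hz hz'.
  rewrite (addrA (- x)); apply: hn => //.
  by apply: pidealD => //; apply: pidealN.
rewrite /Pr -IntZ; last exact: lc_nn.
apply: Int_eq => z _; rewrite linearZ /= nnD addNKr scalerA -psiD.
by congr (psi _ *: _); ring.
Qed.

Lemma Pr_id J y v : (forall x, pideal (- J) x -> nn x v = psi (y * x) *: v) ->
  Pr J y v = v.
Proof.
move=> hv; rewrite /Pr -[RHS](Int_cst F (- J)); apply: Int_eq => x hx.
by rewrite hv// scalerA psiN mulVf ?psi_neq0// scale1r.
Qed.

Lemma Pr_eq0 J y x v (c : R[i]) : pideal (- J) x -> nn x v = c *: v ->
  c != psi (y * x) -> Pr J y v = 0.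
Proof.
move=> hx hv hc; have := Pr_eigen y v hx; rewrite Pr_nnl hv linearZ /=.
by move/eqP; rewrite -subr_eq0 -scalerBl scaler_eq0 subr_eq0 (negPf hc) => /eqP.
Qed.

(** Conjugation by a(u) turns n(x) into n(u x). In the Kirillov model a(u) replaces f(y) by f(y u),
    so it divides the supporting ball by u. *)
Lemma Pr_aa J y u v : u != 0 ->
  aa u (Pr J y v) = Pr (J - lf_val u) (y / u) (aa u v).
Proof.
move=> u0; rewrite /Pr -Int_linear; [|exact: linearP|exact: lc_nn].
have -> : - (J - lf_val u) = lf_val u + - J by lia.
rewrite -(Int_scale u0); last exact: lc_nn.
apply: Int_eq => x _; rewrite linearZ /= aa_nn//.
by congr (psi _ *: _); field.
Qed.

Lemma Pr_shift J y y' v : pideal J (y - y') -> Pr J y v = Pr J y' v.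
Proof.
move=> hy; apply: Int_eq => x hx; congr (_ *: _).
have -> : - (y * x) = - (y' * x) + - (y - y') * x by ring.
rewrite psiD [psi (_ * x)]psi_o ?mulr1// -(subrr J).
by apply: pidealM => //; apply: pidealN.
Qed.

Lemma Pr_comm J K y y' v : Pr K y (Pr J y' v) = Pr J y' (Pr K y v).
Proof.
rewrite [Pr J y' v]/Pr -Int_linear; [|exact: Pr_linear|exact: lc_nn].
by apply: Int_eq => x _; rewrite linearZ /= Pr_nnl.
Qed.

(** For J <= K the ball y + p^K either lies in y' + p^J, as here, or misses it, as in [Pr_Pr0]. *)
Lemma Pr_Pr J K y y' v : J <= K -> pideal J (y - y') ->
  Pr K y (Pr J y' v) = Pr K y v.
Proof.
move=> JK hy; rewrite Pr_comm; apply: Pr_id => x hx.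
rewrite Pr_eigen; last by apply: pidealW hx; lia.
congr (_ *: _); rewrite -[in LHS](subrK y' y) mulrDl psiD psi_o ?mul1r//.
by rewrite -(subrr J); apply: pidealM.
Qed.

Lemma Pr_Pr0 J K y y' v : J <= K -> ~ pideal J (y - y') ->
  Pr K y (Pr J y' v) = 0.
Proof.
move=> JK hy.
have [x hx hxy] : exists2 x, pideal (- J) x & psi (x * (y - y')) != 1.
  by apply: psi_dual; rewrite opprK.
apply: (@Pr_eq0 _ _ x _ (psi (y' * x))).
- by apply: pidealW hx; lia.
- exact: Pr_eigen.
- apply: contraNneq hxy => e.
  by rewrite mulrBr psiD psiN ![x * _]mulrC -e mulfV ?psi_neq0.
Qed.

(** Orthogonality of characters on p^J / p^(J+n): a shift of r by b with psi(b x) <> 1 multiplies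
    the sum by psi(b x). *)
Lemma psi_sum J n x : pideal (- (J + n%:Z)) x ->
  \sum_(r <- reps F J n) psi (r * x) =
  if `[<pideal (- J) x>] then q%:R ^+ n else 0.
Proof.
move=> hx; case: asboolP => [hx'|hx'].
  rewrite (eq_big_seq (fun=> 1)).
    by rewrite big_const_seq count_predT size_reps iter_addr_0 natrX.
  move=> r /mem_reps hr; apply: psi_o; rewrite -(subrr J).
  exact: pidealM.
have [b hb hbx] := psi_dual D hx'.
have : \sum_(r <- reps F J n) psi ((b + r) * x) =
       \sum_(r <- reps F J n) psi (r * x).
  apply: (reps_sum (phi := fun r => b + r) (f := fun r => psi (r * x))
           (reps_is F J n) (reps_is F J n)) => //.
  - by move=> r hr; apply: pidealD.
  - by move=> r r' _ _; rewrite opprD addrACA subrr add0r.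
  - move=> r r' hr hr' hrr'; rewrite -(subrK r' r) mulrDl psiD psi_o ?mul1r//.
    by rewrite -(subrr (J + n%:Z)); apply: pidealM.
rewrite (eq_bigr (fun r => psi (b * x) * psi (r * x))); last first.
  by move=> r _; rewrite mulrDl psiD.
rewrite -mulr_sumr => /eqP; rewrite -subr_eq0 -{2}[\sum_(_ <- _) _]mul1r -mulrBl.
by rewrite mulf_eq0 subr_eq0 (negPf hbx) /= => /eqP.
Qed.

(** A ball is the disjoint union of its subballs. On the dual side, the characters of the subballs
    add up on p^(-J-n) to q^n times the indicator of p^(-J), and q^n cancels the relative
    measure. *)
Lemma Pr_sum J n y v :
  \sum_(r <- reps F J n) Pr (J + n%:Z) (y + r) v = Pr J y v.
Proof.
pose S x := \sum_(r <- reps F J n) (psi (- ((y + r) * x)) *: nn x v).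
have [lcS ->] : lc S (- (J + n%:Z)) /\
    \sum_(r <- reps F J n) Pr (J + n%:Z) (y + r) v = Int (- (J + n%:Z)) S.
  rewrite /S; elim: (reps F J n) => [|r s [lcs IH]].
    split; first by exists 0%N => x z _ _; rewrite !big_nil.
    by rewrite big_nil; under Int_eq do rewrite big_nil; rewrite Int_cst.
  have E x : psi (- ((y + r) * x)) *: nn x v +
      \sum_(r <- s) (psi (- ((y + r) * x)) *: nn x v) =
      \sum_(r <- r :: s) (psi (- ((y + r) * x)) *: nn x v).
    by rewrite big_cons.
  split; first by apply: lc_eq (lcD (lc_nn _ (y + r) v) lcs) => x _.
  by rewrite big_cons IH -IntD//; [apply: Int_eq => x _|exact: lc_nn].
have SE x : pideal (- (J + n%:Z)) x -> S x =
    (if `[<pideal (- J) (- x)>] then q%:R ^+ n else 0) *: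
    (psi (- (y * x)) *: nn x v).
  move=> hx; rewrite /S -scaler_suml scalerA -psi_sum; last exact: pidealN.
  rewrite mulr_suml; congr (_ *: _); apply: eq_bigr => r _.
  by rewrite -psiD; congr psi; ring.
rewrite (Int_supp (n := n) lcS); last first.
  move=> x hx hx'; rewrite SE//; case: asboolP => [/pidealN|]; last by rewrite scale0r.
  by rewrite opprK => h; case: hx'; apply: pidealW h; lia.
have -> : - (J + n%:Z) + n%:Z = - J by lia.
rewrite (Int_eq (g := fun x => q%:R ^+ n *: (psi (- (y * x)) *: nn x v))).
  rewrite IntZ; last exact: lc_nn.
  by rewrite scalerA mulVf ?scale1r// expf_eq0 negb_and qneq0 orbT.
move=> x hx; rewrite SE; last by apply: pidealW hx; lia.
by case: asboolP => // -[]; apply: pidealN.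
Qed.

End Translations.

(** * Eigenvectors from a finite-dimensional cyclic space *)

Section Eigenvector.
Variables (K : closedFieldType) (V : lmodType K) (Theta : V -> V).
Hypothesis Theta_linear : linear Theta.

HB.instance Definition _ :=
  GRing.isLinear.Build K V V *:%R Theta Theta_linear.

Let pact (p : {poly K}) v : V := \sum_(i < size p) p`_i *: iter i Theta v.

Let pactE N (p : {poly K}) v : (size p <= N)%N ->
  pact p v = \sum_(i < N) p`_i *: iter i Theta v.
Proof.
move=> pN; rewrite /pact (big_ord_widen N (fun i => p`_i *: iter i Theta v))//.
rewrite big_mkcond; apply: eq_bigr => i _.
by case: ltnP => // pi; rewrite nth_default ?scale0r.
Qed.

Let pact_factor z (p : {poly K}) v :
  pact (('X - z%:P) * p) v = Theta (pact p v) - z *: pact p v.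
Proof.
have [->|p0] := eqVneq p 0.
  by rewrite mulr0 /pact size_poly0 !big_ord0 linear0 scaler0 subr0.
rewrite (@pactE (size p).+1); last first.
  by apply: leq_trans (size_polyMleq _ _) _; rewrite size_XsubC.
rewrite (eq_bigr (fun i : 'I__ => ('X * p)`_i *: iter i Theta v -
    z *: (p`_i *: iter i Theta v))); last first.
  by move=> i _; rewrite mulrBl coefB coefCM scalerBl scalerA.
rewrite sumrB -scaler_sumr -(@pactE (size p).+1 p)//; congr (_ - _).
rewrite big_ord_recl coefXM eqxx scale0r add0r /pact linear_sum.
by apply: eq_bigr => i _; rewrite coefXM /= linearZ.
Qed.

(** The d + 1 first iterates are linearly dependent, so some nonzero polynomial in Theta kills xi.
    Multiply its linear factors up one at a time: just before the product first kills xi, it maps xi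
    to an eigenvector. *)
Lemma eigenvector_exists (d : nat) (e : 'I_d -> V) xi : xi != 0 ->
  (forall i, exists c : 'I_d -> K, iter i Theta xi = \sum_j c j *: e j) ->
  exists lambda : K, exists2 w : V, w != 0 & Theta w = lambda *: w.
Proof.
move=> xi0 /choice[c cP].
pose M := \matrix_(i < d.+1, j < d) c i j.
have [r r0 rM] : exists2 r : 'rV[K]_d.+1, r != 0 & r *m M = 0.
  exists (nz_row (kermx M)).
    rewrite nz_row_eq0 -mxrank_eq0 mxrank_ker.
    by have := rank_leq_col M; lia.
  by apply/sub_kermxP; apply: nz_row_sub.
pose p : {poly K} := rVpoly r.
have p0 : p != 0.
  by apply: contraNneq r0 => p0; rewrite -(rVpolyK r) -/p p0 linear0.
have pxi : pact p xi = 0.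
  rewrite (@pactE d.+1) ?size_poly//.
  rewrite (eq_bigr (fun i : 'I__ => \sum_j (r 0 i * M i j) *: e j)).
    rewrite exchange_big big1// => j _; rewrite -scaler_suml.
    by have /matrixP/(_ 0 j) := rM; rewrite !mxE => ->; rewrite scale0r.
  move=> i _; rewrite coef_rVpoly_ord cP scaler_sumr.
  by apply: eq_bigr => j _; rewrite scalerA mxE.
have [s ps] := closed_field_poly_normal p.
have {}pxi : pact (\prod_(z <- s) ('X - z%:P)) xi = 0.
  have lp0 : lead_coef p != 0 by rewrite lead_coef_eq0.
  have : lead_coef p *: pact (\prod_(z <- s) ('X - z%:P)) xi = 0.
    rewrite -pxi [in RHS]ps /pact size_scale// scaler_sumr.
    by apply: eq_bigr => i _; rewrite coefZ scalerA.
  by move/eqP; rewrite scaler_eq0 (negPf lp0) => /eqP.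
elim: s {ps} pxi => [|z s IH].
  rewrite big_nil /pact size_poly1 big_ord1 coef1 scale1r /= => h.
  by rewrite h eqxx in xi0.
rewrite big_cons pact_factor => /eqP; rewrite subr_eq0 => /eqP h.
have [/IH//|w0] := eqVneq (pact (\prod_(j <- s) ('X - j%:P)) xi) 0.
by exists z, (pact (\prod_(j <- s) ('X - j%:P)) xi).
Qed.

End Eigenvector.

(** * Gelfand's trick for the operators E pi(g) E *)

Section MultiplicityOne.
Variables (R : realType) (F : localField) (D : unitary_whittaker R F).
Local Notation psi := (uw_psi D).
Local Notation V := (uw_V D).
Local Notation pi := (@uw_pi _ _ D).
Local Notation omega := (uw_omega D).
Local Notation nn := (@nn _ _ D).
Local Notation aa := (@aa _ _ D).
Local Notation ww := (ww D).
Implicit Types (x y z t u a b c d : F) (J K L : int) (v w : V) (k n : nat).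

Local Notation Pr := (@Pr _ _ D).
Variable k : nat.
Hypothesis k_gt0 : (0 < k)%N.
Hypothesis omega_k : forall u, unit_filtration k u -> omega u = 1.

(* In the Kirillov model: multiples of the indicator function of 1 + p^k. *)
Definition bump v : Prop :=
  (forall x, pideal (- k%:Z) x -> nn x v = psi x *: v) /\
  (forall u, unit_filtration k u -> aa u v = v).

(** The Haar measure of the group 1 + p^k is transported from p^k by z |-> 1 + z, because
    multiplication by a unit preserves additive measure. *)
Definition EA v : V := Int k%:Z (fun z => aa (1 + z) v).

Lemma EA_linear : linear EA.
Proof.
move=> c u v; rewrite /EA -IntZ; last exact: lc_aa.
rewrite -IntD; [|by apply: lcZ; exact: lc_aa|exact: lc_aa].
by apply: Int_eq => x _; rewrite linearP.
Qed.

HB.instance Definition _ := GRing.isLinear.Build R[i] V V *:%R EA EA_linear.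

Lemma EA_aal u v : unit_filtration k u -> aa u (EA v) = EA v.
Proof.
move=> uu; have [[u0 vu] hu] := uu.
rewrite /EA -Int_linear; [|exact: linearP|exact: lc_aa].
rewrite (Int_eq (g := fun z => aa (1 + (u * (1 + z) - 1)) v)).
  apply: (Int_isom (f := fun z => aa (1 + z) v) (phi := fun z => u * (1 + z) - 1)).
  - exact: lc_aa.
  - move=> z hz; have -> : u * (1 + z) - 1 = u * z + (u - 1) by ring.
    by apply: pidealD => //; apply: pidealMl => //; apply: ounit_pideal.
  - move=> n x y _ _.
    have -> : u * (1 + x) - 1 - (u * (1 + y) - 1) = u * (x - y) by ring.
    by rewrite -{2}[k%:Z]add0r -addrA; apply: iff_sym; apply: pideal_mul.
move=> z hz; rewrite aaM//; first by congr (aa _ _); ring.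
exact: ufilt_neq0 (ufiltP k_gt0 hz).
Qed.

Lemma EA_id v : (forall u, unit_filtration k u -> aa u v = v) -> EA v = v.
Proof.
move=> hv; rewrite -[RHS](Int_cst F k%:Z); apply: Int_eq => z hz.
by apply: hv; apply: ufiltP.
Qed.

Lemma EA_aar u v : unit_filtration k u -> EA (aa u v) = EA v.
Proof.
move=> uu; rewrite -[RHS](EA_aal _ uu).
rewrite /EA -Int_linear; [|exact: linearP|exact: lc_aa].
apply: Int_eq => z hz; have z0 := ufilt_neq0 (ufiltP k_gt0 hz).
by rewrite !aaM ?(ufilt_neq0 uu)// mulrC.
Qed.

Let inv_pideal z : pideal k%:Z z -> pideal k%:Z ((1 + z)^-1 - 1).
Proof. by move=> /(ufiltP k_gt0)/ufiltV[]. Qed.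

Let inv_isom n x y : pideal k%:Z x -> pideal k%:Z y ->
  pideal (k%:Z + n%:Z) (x - y) <->
  pideal (k%:Z + n%:Z) ((1 + x)^-1 - 1 - ((1 + y)^-1 - 1)).
Proof.
move=> /(ufiltP k_gt0)[ux _] /(ufiltP k_gt0)[uy _].
have [[x0 vx] [y0 vy]] := (ux, uy).
have -> : (1 + x)^-1 - 1 - ((1 + y)^-1 - 1) =
  - ((1 + x)^-1 * (1 + y)^-1) * (x - y) by field; rewrite ?x0 ?y0.
have [w0 vw] : ounit (- ((1 + x)^-1 * (1 + y)^-1)).
  by apply/ounitN/ounitM; apply: ounitV.
by rewrite -{2}[k%:Z]add0r -addrA; apply: iff_sym; apply: pideal_mul.
Qed.

Let aa_invE v z : aa (1 + z)^-1 v = aa (1 + ((1 + z)^-1 - 1)) v.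
Proof. by congr (aa _ _); ring. Qed.

Lemma lc_aa_inv v : lc (fun z => aa (1 + z)^-1 v) k%:Z.
Proof.
apply: lc_eq (lc_isom (lc_aa v k_gt0) inv_pideal inv_isom) => z _.
by rewrite -aa_invE.
Qed.

Lemma EA_inv v : Int k%:Z (fun z => aa (1 + z)^-1 v) = EA v.
Proof.
rewrite (Int_eq (g := fun z => aa (1 + ((1 + z)^-1 - 1)) v)).
  exact: (Int_isom (lc_aa v k_gt0) inv_pideal inv_isom).
by move=> z _; rewrite -aa_invE.
Qed.

Lemma Pr_aaU u v : unit_filtration k u -> Pr k 1 (aa u v) = aa u (Pr k 1 v).
Proof.
move=> [[u0 vu] hu]; rewrite -[Pr k 1 v](Pr_shift _ hu).
by rewrite Pr_aa// vu subr0 divff.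
Qed.

(** The isotypic projection for the compact group of all n(x) a(u), x in p^(-k), u in 1 + p^k, and
    the map n(x) a(u) |-> psi(x); this is a character since (u - 1) x lies in o. *)
Definition EE v : V := EA (Pr k 1 v).

Lemma EE_linear : linear EE.
Proof. by move=> c u v; rewrite /EE !linearP. Qed.

HB.instance Definition _ := GRing.isLinear.Build R[i] V V *:%R EE EE_linear.

Lemma EE_bump v : bump (EE v).
Proof.
split=> [x hx|u hu]; last exact: EA_aal.
rewrite /EE /EA -Int_linear; [|exact: linearP|exact: lc_aa].
rewrite -IntZ; last exact: lc_aa.
apply: Int_eq => z hz; have [uz hz'] := ufiltP k_gt0 hz; have [z0 _] := uz.
rewrite nn_aa// Pr_eigen; last first.
  by apply: pidealMr => //; apply/ounit_pideal/ounitV.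
rewrite linearZ /= mul1r; congr (_ *: _).
have -> : x / (1 + z) = x + - (x * (z / (1 + z))) by field.
rewrite psiD [X in _ * X]psi_o ?mulr1//; apply: pidealN.
rewrite -(addNr k%:Z); apply: pidealM => //.
by apply: pidealMr => //; apply/ounit_pideal/ounitV.
Qed.

Lemma EE_id v : bump v -> EE v = v.
Proof.
move=> [h1 h2]; rewrite /EE Pr_id; first exact: EA_id.
by move=> x hx; rewrite mul1r h1.
Qed.

Lemma EE_aa u v : unit_filtration k u -> EE (aa u v) = EE v.
Proof. by move=> hu; rewrite /EE Pr_aaU// EA_aar. Qed.

(** In the Kirillov model [aa t x] lives on t^(-1) (1 + p^k), which is disjoint from 1 + p^k, and
    n(alpha) does not move supports. *)
Lemma EE_borel_eq0 (alpha t : F) (x : V) : t != 0 -> bump x -> ~ unit_filtration k t ->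
  EE (nn alpha (aa t x)) = 0.
Proof.
move=> t0 [xN xA] tk.
have t1 : ~ pideal k%:Z (t - 1).
  by move=> h; apply: tk; rewrite -(subrK 1 t) addrC; apply: ufiltP.
(* Both b and t b must lie in p^(-k): then n(t b) has eigenvalue psi(b) on the vector, whereas E
   retains only the eigenvalue psi(t b). *)
pose J := Num.max (- k%:Z) (- k%:Z - lf_val t).
have JP : - k%:Z <= J /\ - k%:Z - lf_val t <= J.
  by rewrite !le_max !lexx orbT.
have [b hb hpsi] : exists2 b, pideal J b & psi (b * (t - 1)) != 1.
  apply: psi_dual; have [t_ge0|t_lt0] := leP 0 (lf_val t).
    by have -> : - J = k%:Z by rewrite /J maxEle; case: ifP => ?; lia.
  have -> : - J = k%:Z + lf_val t by rewrite /J maxEle; case: ifP => ?; lia.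
  move=> h; have : pideal (lf_val t + 1) t.
    rewrite -[X in pideal _ X](subrK 1); apply: pidealD.
      by apply: pidealW h; lia.
    by apply: pidealW (@pideal1 F); lia.
  by move=> /(_ t0); lia.
rewrite /EE -Pr_nnl (@Pr_eq0 _ _ _ _ _ (t * b) _ (psi b)) ?linear0//.
- have -> : - k%:Z = lf_val t + (- k%:Z - lf_val t) by lia.
  by apply: pidealM => //; apply: pidealW hb; lia.
- rewrite -aa_nn// xN ?linearZ//.
  by apply: pidealW hb; lia.
- apply: contraNneq hpsi => e.
  by rewrite mulrBr mulr1 psiD psiN e mul1r [b * t]mulrC mulfV ?psi_neq0.
Qed.

Lemma EE_nn_unit (alpha u : F) (x : V) : unit_filtration k u -> bump x ->
  EE (nn (u * alpha) x) = EE (nn alpha x).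
Proof.
move=> uu [_ xA]; have u0 := ufilt_neq0 uu.
by rewrite -{1}(xA _ uu) -aa_nn// EE_aa.
Qed.

(** On the ball 1 + r + p^(k+n) the operator n(alpha) is the scalar psi((1 + r) alpha); a(1 + r)
    then moves this ball to 1 + p^(k+n), which E does not notice. *)
Let bigcell_l (alpha : F) n (y : V) : pideal (- (k + n)%:Z) alpha ->
  EE (nn alpha y) = \sum_(r <- reps F k n)
    psi ((1 + r) * alpha) *: EA (Pr (k + n)%:Z 1 (aa (1 + r) y)).
Proof.
move=> ha; rewrite /EE -Pr_nnl -(Pr_sum _ n) !linear_sum /=.
rewrite !big_seq; apply: eq_bigr => r /mem_reps /(ufiltP k_gt0) ur.
rewrite Pr_eigen// linearZ /= -[in RHS](EA_aar _ (ufiltV ur)).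
have [[r0 vr] _] := ur.
rewrite Pr_aa ?invr_neq0// lf_valV// vr oppr0 subr0 invrK mul1r.
by rewrite aaVK.
Qed.

Let bigcell_r (beta : F) n (x : V) : pideal (- (k + n)%:Z) beta -> bump x ->
  nn beta x = \sum_(s <- reps F k n)
    psi ((1 + s) * beta) *: aa (1 + s)^-1 (Pr (k + n)%:Z 1 x).
Proof.
move=> hb [xN xA].
have -> : nn beta x = nn beta (Pr k 1 x).
  by rewrite Pr_id// => y hy; rewrite mul1r xN.
rewrite -(Pr_sum _ n) linear_sum /=.
rewrite !big_seq; apply: eq_bigr => r /mem_reps /(ufiltP k_gt0) ur.
have [[r0 vr] _] := ur.
rewrite Pr_eigen// -{1}(xA _ (ufiltV ur)).
by rewrite [in RHS]Pr_aa ?invr_neq0// lf_valV// vr oppr0 subr0 invrK mul1r.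
Qed.

(** Up to a scalar matrix in 1 + p^k, where omega is trivial, w a(1 + s)^(-1) is a(1 + s) w. After
    expanding both unipotents, the vectors in the double sum depend only on the product (1 + r) (1 +
    s), so alpha and beta may be exchanged together with r and s. *)
Lemma EE_bigcell (alpha t beta : F) (x : V) : t != 0 -> bump x ->
  EE (nn alpha (aa t (ww (nn beta x)))) = EE (nn beta (aa t (ww (nn alpha x)))).
Proof.
move=> t0 bx.
have [n [ha hb]] : exists n, pideal (- (k + n)%:Z) alpha /\
    pideal (- (k + n)%:Z) beta.
  exists (`|lf_val alpha|%N + `|lf_val beta|%N)%N.
  by split; [apply: pidealW (pideal_val (x := alpha))|
             apply: pidealW (pideal_val (x := beta))]; lia.
pose G s := EA (Pr (k + n)%:Z 1 (aa s (ww (Pr (k + n)%:Z 1 x)))).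
have expand a b : pideal (- (k + n)%:Z) a -> pideal (- (k + n)%:Z) b ->
  EE (nn a (aa t (ww (nn b x)))) =
  \sum_(r <- reps F k n) \sum_(s <- reps F k n)
    (psi ((1 + r) * a) * psi ((1 + s) * b)) *: G (t * ((1 + r) * (1 + s))).
  move=> ha' hb'; rewrite (bigcell_l _ ha') !big_seq; apply: eq_bigr => r.
  move=> /mem_reps /(ufiltP k_gt0) /ufilt_neq0 r0.
  rewrite (bigcell_r hb' bx) !linear_sum /= !big_seq.
  apply: eq_bigr => s /mem_reps /(ufiltP k_gt0) us.
  have s0 := ufilt_neq0 us.
  rewrite !linearZ /= scalerA. congr (_ *: _); first exact: mulrC.
  rewrite /G; congr (EA (Pr _ _ _)).
  rewrite -[RHS]scale1r -(omega_k (ufiltV us)) -act_scalar ?invr_neq0//.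
  mxact.
rewrite !expand// exchange_big; apply: eq_bigr => r _; apply: eq_bigr => s _.
by congr (_ *: G (t * _)); exact: mulrC.
Qed.

(* Invariance of the operators E pi(g) E under the anti-involution
   [a b; c d] |-> [d b; c a]. *)
Lemma EE_sigma a b c d (x : V) : a * d - b * c != 0 -> bump x ->
  EE (pi (G2 a b c d) x) = EE (pi (G2 d b c a) x).
Proof.
move=> det0 bx; have [c0|c0] := eqVneq c 0.
  move: det0; rewrite c0 mulr0 subr0 mulf_eq0 negb_or => /andP[a0 d0].
  have E a' d' : a' != 0 -> d' != 0 -> EE (pi (G2 a' b 0 d') x) =
      omega d' *: EE (nn (b / d') (aa (a' / d') x)).
    move=> a0' d0'; rewrite -linearZ /= -act_scalar//; congr EE.
    by mxact.
  rewrite !E//; have [u|nu] := pselect (unit_filtration k (a / d)); last first.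
    rewrite !EE_borel_eq0 ?scaler0 ?mulf_neq0 ?invr_neq0//.
    by move=> /ufiltV; rewrite invf_div.
  have u' : unit_filtration k (d / a) by rewrite -invf_div; apply: ufiltV.
  have [_ xA] := bx; rewrite !xA//.
  have -> : omega a = omega d.
    have -> : omega a = omega (a / d * d) by rewrite divfK.
    by rewrite omegaM ?mulf_neq0 ?invr_neq0// omega_k// mul1r.
  have -> : b / a = (d / a) * (b / d) by field; rewrite ?a0 ?d0.
  by rewrite (EE_nn_unit (b / d) u').
(* In this Bruhat decomposition the torus part is symmetric in a and d, so the anti-involution
   merely exchanges alpha = a/c and beta = d/c. *)
have E a' d' : a' * d' - b * c != 0 -> EE (pi (G2 a' b c d') x) =
    omega c *: EE (nn (a' / c) (aa ((b * c - a' * d') / c ^+ 2) (ww (nn (d' / c) x)))).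
  move=> det0'; rewrite -linearZ /= -act_scalar//; congr EE.
  have det1 : b * c - a' * d' != 0 by rewrite -oppr_eq0 opprB.
  mxact.
rewrite !E// 1?mulrC// [d * a]mulrC; congr (_ *: _); apply: EE_bigcell => //.
by rewrite mulf_neq0 ?invr_neq0 ?expf_neq0// -oppr_eq0 opprB.
Qed.

(** Write s for the anti-involution. Expanding the middle E and applying [EE_sigma] under the
    integral turns E g E h E into E s(h) E s(g) E; applying [EE_sigma] to each factor turns the
    latter into E h E g E. *)
Lemma EE_commute a b c d a' b' c' d' (x : V) :
  a * d - b * c != 0 -> a' * d' - b' * c' != 0 -> bump x ->
  EE (pi (G2 a b c d) (EE (pi (G2 a' b' c' d') x))) =
  EE (pi (G2 a' b' c' d') (EE (pi (G2 a b c d) x))).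
Proof.
move=> dg dh bx; set g := pi (G2 a b c d); set h := pi (G2 a' b' c' d').
pose sg := pi (G2 d b c a); pose sh := pi (G2 d' b' c' a').
have dsg : d * a - b * c != 0 by rewrite mulrC.
have dsh : d' * a' - b' * c' != 0 by rewrite mulrC.
have -> : EE (h (EE (g x))) = EE (sh (EE (sg x))).
  by rewrite /h EE_sigma//; [congr (EE (sh _)); rewrite /g EE_sigma|exact: EE_bump].
have E1 : EE (g (EE (h x))) = Int k%:Z (fun z => Int (- k%:Z) (fun y =>
    psi (- (1 * y)) *: EE (g (aa (1 + z) (nn y (h x)))))).
  rewrite {2}/EE /EA -(Int_linear (phi := fun w => EE (g w))); first last.
  - exact: lc_aa.
  - by move=> e u w; rewrite !linearP.
  apply: Int_eq => z _; rewrite /Pr.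
  rewrite -(Int_linear (phi := fun w => EE (g (aa (1 + z) w)))); first last.
  - exact: lc_nn.
  - by move=> e u w; rewrite !linearP.
  by apply: Int_eq => y _; rewrite !linearZ.
(* The middle E is written with its two factors in the opposite order and with u inverted, because
   the anti-involution fixes n(y) and sends a(u) to the scalar u times a(u^(-1)). *)
have E2 : EE (sh (EE (sg x))) = Int k%:Z (fun z => Int (- k%:Z) (fun y =>
    psi (- (1 * y)) *: EE (sh (nn y (aa (1 + z)^-1 (sg x)))))).
  rewrite {2}/EE -EA_inv.
  rewrite (Int_eq (g := fun z => Pr k 1 (aa (1 + z)^-1 (sg x)))); last first.
    by move=> z /(ufiltP k_gt0)/ufiltV u; rewrite Pr_aaU.
  rewrite -(Int_linear (phi := fun w => EE (sh w))); first last.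
  - apply: lc_eq (lc_aa_inv (Pr k 1 (sg x))) => z /(ufiltP k_gt0)/ufiltV uz.
    by rewrite Pr_aaU.
  - by move=> e u w; rewrite !linearP.
  apply: Int_eq => z _; rewrite /Pr.
  rewrite -(Int_linear (phi := fun w => EE (sh w))); first last.
  - exact: lc_nn.
  - by move=> e u w; rewrite !linearP.
  by apply: Int_eq => y _; rewrite !linearZ.
rewrite E1 E2; apply: Int_eq => z /(ufiltP k_gt0) uz; apply: Int_eq => y _.
congr (_ *: _); have z0 := ufilt_neq0 uz; set u := 1 + z in uz z0 *.
have -> w : aa u^-1 w = pi (G2 1 0 0 u) w.
  rewrite -[LHS]scale1r -(omega_k uz) -act_scalar//; mxact.
have D1 : (a' + y * c') * d' - (b' + y * d') * c' != 0.
  by have -> : (a' + y * c') * d' - (b' + y * d') * c' = a' * d' - b' * c' by ring.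
have -> : g (aa u (nn y (h x))) =
    pi (G2 (a * u * (a' + y * c') + b * c') (a * u * (b' + y * d') + b * d')
           (c * u * (a' + y * c') + d * c') (c * u * (b' + y * d') + d * d')) x.
  have D2 : a * u * d - b * (c * u) != 0.
    have -> : a * u * d - b * (c * u) = u * (a * d - b * c) by ring.
    by rewrite mulf_neq0.
  have D3 : a * u * (c * u * y + d) - (a * u * y + b) * (c * u) != 0.
    have -> : a * u * (c * u * y + d) - (a * u * y + b) * (c * u) =
      u * (a * d - b * c) by ring.
    by rewrite mulf_neq0.
  by rewrite /g /h /nn /aa !actM; [apply: act_eq; ring|nz..].
rewrite EE_sigma//.
  have D4 : d' * ((c' * y + a') * u) - (d' * y + b') * u * c' != 0.
    have -> : d' * ((c' * y + a') * u) - (d' * y + b') * u * c' =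
      u * (a' * d' - b' * c') by ring.
    by rewrite mulf_neq0.
  have D5 : d' * (c' * y + a') - (d' * y + b') * c' != 0.
    by have -> : d' * (c' * y + a') - (d' * y + b') * c' = a' * d' - b' * c' by ring.
  by congr EE; rewrite /sg /sh /nn !actM; [apply: act_eq; ring|nz..].
have -> : (a * u * (a' + y * c') + b * c') * (c * u * (b' + y * d') + d * d') -
    (a * u * (b' + y * d') + b * d') * (c * u * (a' + y * c') + d * c') =
    u * (a * d - b * c) * (a' * d' - b' * c') by ring.
by rewrite !mulf_neq0.
Qed.

End MultiplicityOne.

(** * Schur's lemma: bump vectors form a line *)

Section Uniqueness.
Variables (R : realType) (F : localField) (D : unitary_whittaker R F).
Local Notation V := (uw_V D).
Local Notation pi := (@uw_pi _ _ D).
Variable k : nat.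
Hypothesis k_gt0 : (0 < k)%N.
Hypothesis omega_k : forall u, unit_filtration k u -> uw_omega D u = 1.
Local Notation E := (@EE _ _ D k).
Local Notation bump := (@bump _ _ D k).
Implicit Types (u v w : V) (g h : GL2 F).

Let E_linear := EE_linear (D := D) k_gt0.

Let E0 : E 0 = 0.
Proof. by have := E_linear (- 1) 0 0; rewrite scaler0 addr0 scaleN1r addNr. Qed.

Let EB u v : E (u - v) = E u - E v.
Proof. by have := E_linear (-1) v u; rewrite !scaleN1r ![- _ + _]addrC. Qed.

Let E_pi a h u v : E (pi h (a *: u + v)) = a *: E (pi h u) + E (pi h v).
Proof. by rewrite linearP E_linear. Qed.

Let E_comm g h v : bump v -> E (pi g (E (pi h v))) = E (pi h (E (pi g v))).
Proof.
have [a [b [c [d [dg -> _]]]]] := G2P g.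
have [a' [b' [c' [d' [dh -> _]]]]] := G2P h.
exact: EE_commute.
Qed.

Let invariant_full (S : set V) v : is_subspace S ->
  (forall g u, S u -> S (pi g u)) -> S v -> v != 0 -> forall u, S u.
Proof.
move=> Ss Sg Sv v0 u; case: ((uw_irr D).2 S Ss Sg) => SE; last by rewrite SE.
by move: Sv; rewrite SE => /= e; rewrite e eqxx in v0.
Qed.

Let E_separates xi u : bump xi -> xi != 0 -> (forall h, E (pi h u) = 0) -> u = 0.
Proof.
move=> bxi xi0 hu.
pose S := [set w : V | forall h, E (pi h w) = 0].
have Ss : is_subspace S.
  split=> [h|a w1 w2 h1 h2 h]; first by rewrite linear0.
  by rewrite E_pi h1 h2 scaler0 addr0.
have Sg g w : S w -> S (pi g w) by move=> hw h; rewrite -actG.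
case: ((uw_irr D).2 S Ss Sg) => SE; first by have : S u by []; rewrite SE.
have : S xi by rewrite SE.
move=> /(_ 1%g); rewrite (uw_piP D).1 EE_id// => e.
by rewrite e eqxx in xi0.
Qed.

(* The operator E pi(g) E on bump vectors extends to an endomorphism of the
   representation, hence is scalar by Schur's lemma. *)
Lemma EE_scalar xi g : bump xi -> xi != 0 ->
  exists lambda : R[i], E (pi g xi) = lambda *: xi.
Proof.
move=> bxi xi0.
(* The graph of the sought endomorphism Theta: each E pi(h) v is a bump vector, on which Theta must
   act as E pi(g), and these vectors determine v. *)
pose Gam v v' := forall h, E (pi h v') = E (pi g (E (pi h v))).
have Gam_uniq v v1 v2 : Gam v v1 -> Gam v v2 -> v1 = v2.
  move=> h1 h2; apply/eqP; rewrite -subr_eq0; apply/eqP.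
  by apply: (E_separates bxi xi0) => h; rewrite linearB EB h1 h2 subrr.
have Gam_lin a v1 v2 v1' v2' : Gam v1 v1' -> Gam v2 v2' ->
    Gam (a *: v1 + v2) (a *: v1' + v2').
  by move=> h1 h2 h; rewrite !E_pi h1 h2.
have Gam_pi g' v v' : Gam v v' -> Gam (pi g' v) (pi g' v').
  by move=> hv h; rewrite -!actG.
have Gam_bump v : bump v -> Gam v (E (pi g v)) by move=> bv h; apply: E_comm.
have dom v : exists v', Gam v v'.
  apply: (@invariant_full [set v | exists v', Gam v v'] xi) => //.
  - split=> [|a v1 v2 [v1' h1] [v2' h2]]; last by exists (a *: v1' + v2'); apply: Gam_lin.
    by exists 0 => h; rewrite !(linear0, E0).
  - by move=> g' u [u' hu]; exists (pi g' u'); apply: Gam_pi.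
  - by exists (E (pi g xi)); apply: Gam_bump.
have [Th ThP] := choice dom.
have Theta_linear : linear Th.
  by move=> a u v; apply: (Gam_uniq (a *: u + v)); [|apply: Gam_lin].
have Theta_pi h v : Th (pi h v) = pi h (Th v).
  by apply: (Gam_uniq (pi h v)); [|apply: Gam_pi].
(* Theta commutes with the stabilizer of xi, which is open, so the iterates of xi stay in its fixed
   space, finite-dimensional by admissibility. *)
have [d [e eP]] := (uw_adm D).2 _ ((uw_adm D).1 xi).
have iterP i h : pi h xi = xi -> pi h (iter i Th xi) = iter i Th xi.
  by move=> hxi; elim: i => //= i IH; rewrite -Theta_pi IH.
have [lambda [w w0 hw]] : exists lambda : R[i],
    exists2 w : V, w != 0 & Th w = lambda *: w.
  apply: (@eigenvector_exists R[i] V Th Theta_linear d e xi) => // i.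
  by apply: eP => h /= hxi; apply: iterP.
have Theta0 : Th 0 = 0.
  by apply: (Gam_uniq 0) => // h; rewrite !(linear0, E0).
have scal v : Th v = lambda *: v.
  apply: (@invariant_full [set v | Th v = lambda *: v] w) => //.
  - split=> [|a v1 v2 /= h1 h2]; first by rewrite /= Theta0 scaler0.
    by rewrite Theta_linear h1 h2 scalerDr !scalerA mulrC.
  - by move=> h u /= hu; rewrite Theta_pi hu linearZ.
exists lambda; rewrite -scal.
by apply: (Gam_uniq xi) => //; apply: Gam_bump.
Qed.

(** The vectors w such that every E pi(h) w is a multiple of xi form an invariant subspace; it
    contains xi by [EE_scalar], so it is everything. A bump vector v equals E v. *)
Lemma bump_unique xi v : bump xi -> xi != 0 -> bump v ->
  exists c : R[i], v = c *: xi.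
Proof.
move=> bxi xi0 bv.
have : forall h, exists c : R[i], E (pi h v) = c *: xi.
  apply: (@invariant_full [set w | forall h, exists c : R[i],
    E (pi h w) = c *: xi] xi) => //.
  - split=> [h|a v1 v2 h1 h2 h]; first by exists 0; rewrite !(linear0, E0, scale0r).
    have [c1 e1] := h1 h; have [c2 e2] := h2 h.
    by exists (a * c1 + c2); rewrite E_pi e1 e2 scalerDl scalerA.
  - by move=> g w hw h; have [c e] := hw (h * g)%g; exists c; rewrite -actG.
  - by move=> h; apply: EE_scalar.
by move=> /(_ 1%g)[c]; rewrite (uw_piP D).1 EE_id// => ->; exists c.
Qed.

End Uniqueness.

(** * The invariant inner product on spectral balls *)

Section Norms.
Variables (R : realType) (F : localField) (D : unitary_whittaker R F).
Local Notation psi := (uw_psi D).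
Local Notation V := (uw_V D).
Local Notation pi := (@uw_pi _ _ D).
Local Notation omega := (uw_omega D).
Local Notation ell := (@uw_ell _ _ D).
Local Notation H := (uw_H D).
Local Notation nn := (@nn _ _ D).
Local Notation aa := (@aa _ _ D).
Implicit Types (x y z t u a b c d : F) (J K L : int) (v w : V) (k n : nat).

Local Notation Pr := (@Pr _ _ D).
Local Notation bump := (@bump _ _ D).

Lemma HC (u v : V) : H u v = (H v u)^*.
Proof. by rewrite hermC expr0 mul1r. Qed.

Lemma H_inv g (u v : V) : H (pi g u) (pi g v) = H u v.
Proof. exact: uw_inv. Qed.

Lemma H_ge0 v : 0 <= H v v.
Proof. exact: dnorm_ge0. Qed.

Lemma HZl (c : R[i]) (u v : V) : H (c *: u) v = c * H u v.
Proof. exact: linearZl_LR. Qed.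

Lemma HZr (c : R[i]) (u v : V) : H u (c *: v) = c^* * H u v.
Proof. exact: linearZr_LR. Qed.

Lemma HZ (c : R[i]) v : H (c *: v) (c *: v) = `|c| ^+ 2 * H v v.
Proof. by rewrite HZl HZr mulrA normCK. Qed.

Lemma HDl (u v w : V) : H (u + v) w = H u w + H v w.
Proof. exact: linearDl. Qed.

Lemma HDr (u v w : V) : H w (u + v) = H w u + H w v.
Proof. exact: linearDr. Qed.

Lemma H_orthD (u v : V) : H u v = 0 -> H (u + v) (u + v) = H u u + H v v.
Proof.
by move=> uv; rewrite HDl !HDr uv (HC v) uv conjC0 addr0 add0r.
Qed.

Lemma psi_conj x : (psi x)^* = (psi x)^-1.
Proof.
apply: (mulfI (psi_neq0 D x)); rewrite divff ?psi_neq0//.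
by rewrite -normCK psi_norm expr1n.
Qed.

Lemma nn_norm1 v w x y z : nn x v = psi y *: v -> nn x w = psi z *: w ->
  psi y != psi z -> H v w = 0.
Proof.
move=> hv hw hyz; have := H_inv (G2 1 x 0 1) v w.
rewrite -!/(nn _) hv hw HZl HZr psi_conj mulrA => /eqP.
rewrite -subr_eq0 -{2}[H v w]mul1r -mulrBl mulf_eq0 subr_eq0 => /orP[/eqP e|/eqP//].
case/eqP: hyz; rewrite -[LHS]mulr1 -(mulVf (psi_neq0 D z)) mulrA e.
by rewrite mul1r.
Qed.

Lemma Pr_orth J y y' v w : ~ pideal J (y - y') -> H (Pr J y v) (Pr J y' w) = 0.
Proof.
move=> hy; have [x hx hxy] : exists2 x, pideal (- J) x & psi (x * (y - y')) != 1.
  by apply: psi_dual; rewrite opprK.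
apply: (nn_norm1 (Pr_eigen y v hx) (Pr_eigen y' w hx)).
apply: contraNneq hxy => e.
by rewrite mulrBr psiD psiN ![x * _]mulrC -e mulfV ?psi_neq0.
Qed.

(** Unitarity of n(x) makes the projection orthogonal: every term of the average equals the
    right-hand side. *)
Lemma H_Pr J y v w : H (Pr J y v) (Pr J y w) = H v (Pr J y w).
Proof.
set a := Pr J y w; rewrite /Pr.
pose phi (u : V) : R[i]^o := H u a.
have phiL : linear phi by move=> c u1 u2; rewrite /phi HDl HZl.
rewrite -[LHS]/(phi _) -Int_linear//; last exact: lc_nn.
rewrite -[RHS](Int_cst F (- J) (H v a : R[i]^o)); apply: Int_eq => x hx.
rewrite /phi HZl -(H_inv (G2 1 (- x) 0 1)) -!/(nn _) nnD addNr nn0.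
rewrite Pr_eigen; last exact: pidealN.
rewrite HZr psi_conj mulrA -[- (y * x)]mulrN divff ?mul1r//.
exact: psi_neq0.
Qed.

Definition separated J (s : seq F) : Prop :=
  uniq s /\ forall x y, x \in s -> y \in s -> pideal J (x - y) -> x = y.

Lemma separated_cons J x (s : seq F) : separated J (x :: s) ->
  separated J s /\ forall y, y \in s -> ~ pideal J (x - y).
Proof.
move=> [/= /andP[xs us] hs]; split.
  by split=> // y z ys zs; apply: hs; rewrite inE ?ys ?zs orbT.
move=> y ys hxy; case/negP: xs.
by rewrite (hs x y _ _ hxy) ?inE ?eqxx ?ys ?orbT.
Qed.

Lemma separated_reps J n : separated (J + n%:Z) (reps F J n).
Proof. by have [h1 _ _ h2] := reps_is F J n. Qed.

Lemma Pr_sum_norm K (s : seq F) v : separated K s ->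
  H (\sum_(y <- s) Pr K y v) (\sum_(y <- s) Pr K y v) =
  \sum_(y <- s) H (Pr K y v) (Pr K y v).
Proof.
elim: s => [|x s IH] ss; first by rewrite !big_nil linear0l.
have [ss' xs] := separated_cons ss.
rewrite !big_cons -IH// H_orthD// linear_sumr/= big1_seq// => y /andP[_ ys].
by apply: Pr_orth; apply: xs.
Qed.

Lemma Pr_bessel K (s : seq F) v : separated K s ->
  \sum_(y <- s) H (Pr K y v) (Pr K y v) <= H v v.
Proof.
move=> ss; rewrite -(Pr_sum_norm v ss); set S := \sum_(y <- s) _.
have HSS : H S S = H v S.
  rewrite Pr_sum_norm// [in RHS]/S linear_sumr /=.
  by apply: eq_bigr => y _; rewrite H_Pr.
have -> : H v v = H S S + H (v - S) (v - S).
  rewrite -H_orthD; first by rewrite addrC subrK.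
  by rewrite HC linearBl /= HSS subrr conjC0.
by rewrite lerDl H_ge0.
Qed.

Lemma ell_linear : linear (ell : V -> R[i]^o).
Proof. exact: uw_ellL. Qed.

Lemma ell0 : ell 0 = 0.
Proof. by have := ell_linear (-1) 0 0; rewrite scaler0 addr0 scaleN1r addNr. Qed.

Lemma ellD (v w : V) : ell (v + w) = ell v + ell w.
Proof. by rewrite -[v]scale1r uw_ellL mul1r scale1r. Qed.

Lemma ellZ (c : R[i]) v : ell (c *: v) = c * ell v.
Proof. by have := uw_ellL c v 0; rewrite !addr0 ell0 addr0. Qed.

Lemma ell_nn x v : ell (nn x v) = psi x * ell v.
Proof. by rewrite /nn -unipotentE uw_ellN. Qed.

(** In the Kirillov model ell is evaluation at 1, the centre of the ball to which one restricts. *)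
Lemma ell_Pr J v : ell (Pr J 1 v) = ell v.
Proof.
rewrite /Pr -[LHS](@Int_linear _ _ _ _ (ell : V -> R[i]^o)).
- rewrite -[RHS](Int_cst F (- J) (ell v : R[i]^o)); apply: Int_eq => x _.
  by rewrite ellZ ell_nn mul1r mulrA psiN mulVf ?mul1r ?psi_neq0.
- exact: ell_linear.
- exact: lc_nn.
Qed.

Lemma Pr_bump k v : (0 < k)%N -> (forall u, unit_filtration k u -> aa u v = v) ->
  bump k (Pr k 1 v).
Proof.
move=> k0 hv; split=> [x hx|u hu]; first by rewrite Pr_eigen// mul1r.
by rewrite -Pr_aaU// hv.
Qed.

Section Kirillov.
Variables (k : nat) (xi : V).
Hypothesis k_gt0 : (0 < k)%N.
Hypothesis omega_k : forall u, unit_filtration k u -> omega u = 1.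
Hypothesis xi_bump : bump k xi.
Hypothesis ell_xi : ell xi = 1.

(** Moved to 1 + p^k by a(y), the projection is a bump vector, hence a multiple of xi, and ell reads
    off the factor. *)
Lemma Pr_kirillov v y : y != 0 -> (forall u, unit_filtration k u -> aa u v = v) ->
  Pr (k%:Z + lf_val y) y v = ell (aa y v) *: aa y^-1 xi.
Proof.
move=> y0 hv.
have xi0 : xi != 0.
  apply/eqP => e; have /eqP := ell_xi; rewrite e -(scale0r 0) ellZ mul0r.
  by rewrite eq_sym oner_eq0.
have hv' u : unit_filtration k u -> aa u (aa y v) = aa y v.
  by move=> hu; have u0 := ufilt_neq0 hu; rewrite aaM// mulrC -aaM// hv.
have [c hc] := bump_unique k_gt0 omega_k xi_bump xi0 (Pr_bump k_gt0 hv').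
have {}hc : Pr k 1 (aa y v) = ell (aa y v) *: xi.
  by rewrite hc; congr (_ *: _); rewrite -(ell_Pr k) hc ellZ ell_xi mulr1.
rewrite -linearZ /= -hc Pr_aa ?invr_neq0// lf_valV// opprK invrK mul1r.
by rewrite aaVK.
Qed.

Lemma Pr_kirillov_norm v y : y != 0 ->
  (forall u, unit_filtration k u -> aa u v = v) ->
  H (Pr (k%:Z + lf_val y) y v) (Pr (k%:Z + lf_val y) y v) =
  `|ell (aa y v)| ^+ 2 * H xi xi.
Proof. by move=> y0 hv; rewrite Pr_kirillov// HZ H_inv. Qed.

Lemma kirillov_bessel (s : seq F) J v :
  (forall u, unit_filtration k u -> aa u v = v) ->
  separated (k%:Z + J) s -> (forall y, y \in s -> y != 0 /\ lf_val y = J) ->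
  (\sum_(y <- s) `|ell (aa y v)| ^+ 2) * H xi xi <= H v v.
Proof.
move=> hv ss sJ; apply: le_trans (Pr_bessel v ss).
rewrite mulr_suml !big_seq; apply: ler_sum => y /sJ[y0 <-].
by rewrite Pr_kirillov_norm.
Qed.

Lemma kirillov_parseval (s : seq F) J v :
  (forall u, unit_filtration k u -> aa u v = v) ->
  separated (k%:Z + J) s -> (forall y, y \in s -> y != 0 /\ lf_val y = J) ->
  \sum_(y <- s) Pr (k%:Z + J) y v = v ->
  H v v = (\sum_(y <- s) `|ell (aa y v)| ^+ 2) * H xi xi.
Proof.
move=> hv ss sJ sv; rewrite -{1 2}sv Pr_sum_norm// mulr_suml !big_seq.
by apply: eq_bigr => y /sJ[y0 <-]; rewrite Pr_kirillov_norm.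
Qed.

End Kirillov.

End Norms.

(** * Newvectors, the Hecke operator, and the part on p *)

Section Newvectors.
Variables (R : realType) (F : localField) (D : unitary_whittaker R F).
Local Notation V := (uw_V D).
Local Notation pi := (@uw_pi _ _ D).
Local Notation omega := (uw_omega D).
Local Notation H := (uw_H D).
Local Notation q := (residue_card F).
Local Notation nn := (@nn _ _ D).
Local Notation aa := (@aa _ _ D).
Local Notation lw := (@lw _ _ D).
Local Notation ww := (ww D).
Implicit Types (x y z t u a b c d : F) (J K L : int) (v w : V) (k n : nat).

Local Notation Pr := (@Pr _ _ D).

(** Entrywise form of invariance under K_1(p^n), suited to explicit matrices; [K1_G2] and
    [K1_entries] translate to and from [K1]. *)
Definition K1_fixed n v : Prop := forall a b c d,
  pideal 0 a -> pideal 0 b -> pideal 0 d -> ounit (a * d - b * c) ->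
  pideal n%:Z (a - 1) -> pideal n%:Z c -> pi (G2 a b c d) v = v.

Lemma K1_fixed_nn n v x : K1_fixed n v -> pideal 0 x -> nn x v = v.
Proof.
move=> hv hx; apply: hv; rewrite ?subrr//; try exact: pideal1; try exact: pideal0.
by rewrite mulr1 mulr0 subr0; apply: ounit1.
Qed.

Lemma K1_fixed_lw n v c : K1_fixed n v -> pideal n%:Z c -> lw c v = v.
Proof.
move=> hv hc; apply: hv; rewrite ?subrr//; try exact: pideal1; try exact: pideal0.
by rewrite mulr1 mul0r subr0; apply: ounit1.
Qed.

Lemma K1_fixed_diag n v e d : K1_fixed n v -> ounit e -> ounit d -> omega e = 1 ->
  pi (G2 e 0 0 d) v = v.
Proof.
move=> hv [e0 ve] ud oe; have [d0 vd] := ud.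
have <- : pi (G2 e 0 0 e) (pi (G2 1 0 0 (d / e)) v) = pi (G2 e 0 0 d) v.
  by mxact.
rewrite act_scalar// oe scale1r.
have ude : ounit (d / e) by apply: ounitM => //; apply: ounitV.
apply: hv; rewrite ?subrr//; try exact: pideal1; try exact: pideal0.
- exact: ounit_pideal.
- by rewrite mul1r mul0r subr0.
Qed.

Lemma K1_fixed_aa n v u : K1_fixed n v -> ounit u -> aa u v = omega u *: v.
Proof.
move=> hv uu; have [u0 vu] := uu.
have -> : aa u v = pi (G2 u 0 0 u) (pi (G2 1 0 0 u^-1) v) by mxact.
rewrite act_scalar//; congr (_ *: _).
have ude : ounit u^-1 by apply: ounitV.
apply: hv; rewrite ?subrr//; try exact: pideal1; try exact: pideal0.
- exact: ounit_pideal.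
- by rewrite mul1r mul0r subr0.
Qed.

Lemma omega_norm z : z != 0 -> `|omega z| = 1.
Proof.
move=> z0; have [[v v0] _] := uw_irr D.
have := H_inv (G2 z 0 0 z) v v; rewrite act_scalar// HZ => /eqP.
rewrite -subr_eq0 -{2}[H v v]mul1r -mulrBl mulf_eq0 subr_eq0.
rewrite dnorm_eq0 (negPf v0) orbF => /eqP h.
by apply/eqP; rewrite -(@eqrXn2 _ 2) ?normr_ge0// h expr1n.
Qed.

Lemma K1_fixed_omega n v u : K1_fixed n v -> v != 0 -> unit_filtration n u ->
  omega u = 1.
Proof.
move=> hv v0 [[u0 vu] hu]; have uu : ounit u by [].
have : omega u *: v = 1 *: v.
  rewrite -act_scalar// scale1r; apply: hv => //; try exact: ounit_pideal.
  - exact: pideal0.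
  - by rewrite mul0r subr0; apply: ounitM.
  - exact: pideal0.
by move/eqP; rewrite -subr_eq0 -scalerBl scaler_eq0 (negPf v0) orbF subr_eq0 => /eqP.
Qed.

Lemma bruhat_lower a b c d v : d != 0 -> a * d - b * c != 0 ->
  pi (G2 a b c d) v = nn (b / d) (pi (G2 ((a * d - b * c) / d) 0 0 d) (lw (c / d) v)).
Proof. by move=> d0 det0; mxact. Qed.

Lemma lw_nn c r v : 1 + c * r != 0 -> lw c (nn r v) = nn (r / (1 + c * r))
  (pi (G2 (1 + c * r)^-1 0 0 (1 + c * r)) (lw (c / (1 + c * r)) v)).
Proof. by move=> h; mxact. Qed.

Lemma ww_nn r v : r != 0 ->
  ww (nn r v) = nn r^-1 (pi (G2 (- r^-1) 0 0 r) (lw r^-1 v)).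
Proof. by move=> h; mxact; rewrite invr_neq0. Qed.

(** Iwahori factorization: at positive level the entry d is a unit, and the group is the product of
    its upper unipotent, diagonal and lower unipotent parts. *)
Lemma K1_fixedS j w : (forall x, pideal 0 x -> nn x w = w) ->
  (forall e d, unit_filtration j.+1 e -> ounit d -> pi (G2 e 0 0 d) w = w) ->
  (forall c, pideal j.+1%:Z c -> lw c w = w) -> K1_fixed j.+1 w.
Proof.
move=> hN hA hL a b c d ha hb hd udet ha1 hc.
have [det0 _] := udet.
have ud : ounit d.
  apply: ounitP => // hd1; apply: (ounit_pidealN udet); apply: pidealB.
    exact: pidealMl.
  by apply: pidealMl => //; apply: pidealW hc; lia.
have [d0 vd] := ud; have ud' := ounit_pideal (ounitV ud).
rewrite bruhat_lower// hL; last by apply: pidealMr.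
rewrite hA//; first by rewrite hN//; apply: pidealMr.
split; first by apply: ounitM => //; apply: ounitV.
have -> : (a * d - b * c) / d - 1 = (a - 1) - b * (c / d) by field.
by apply: pidealB => //; apply: pidealMl => //; apply: pidealMr.
Qed.

Lemma K1_fixed0 w : (forall x, pideal 0 x -> nn x w = w) ->
  (forall e d, ounit e -> ounit d -> pi (G2 e 0 0 d) w = w) ->
  ww w = w -> K1_fixed 0 w.
Proof.
move=> hN hA hW.
have hL c : pideal 0 c -> lw c w = w.
  move=> hc; have -> : lw c w = ww (nn c (ww w)) by mxact.
  by rewrite hW hN.
have hd a b c d : pideal 0 a -> pideal 0 b -> pideal 0 c -> ounit d ->
    ounit (a * d - b * c) -> pi (G2 a b c d) w = w.
  move=> ha hb hc ud udet; have [d0 vd] := ud; have [det0 _] := udet.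
  have ud' := ounit_pideal (ounitV ud).
  rewrite bruhat_lower// hL; last by apply: pidealMr.
  rewrite hA//; last by apply: ounitM => //; apply: ounitV.
  by rewrite hN//; apply: pidealMr.
move=> a b c d ha hb hd' udet _ hc; have [det0 _] := udet.
have [hd1|nd1] := pselect (pideal 1 d); last by apply: hd => //; apply: ounitP.
have uc : ounit c.
  apply: ounitP => // hc1; apply: (ounit_pidealN udet).
  by apply: pidealB; [apply: pidealMl|apply: pidealMl].
have det1 : b * c - a * d != 0 by rewrite -oppr_eq0 opprB.
rewrite -{1}hW.
have -> : pi (G2 a b c d) (ww w) = pi (G2 b a d c) w by mxact.
apply: hd => //.
by rewrite -opprB; apply: ounitN.
Qed.

Section Hecke.
Variables (n j : nat) (v : V) (p : F).
Hypothesis p0 : p != 0.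
Hypothesis vp : lf_val p = 1.
Hypothesis vK : K1_fixed n v.
Hypothesis nj : (n <= j.+1)%N.
Hypothesis omega_j : forall u, unit_filtration j u -> omega u = 1.

(** In the Kirillov model, f becomes q times the restriction of y |-> f(p y) to o; so it measures
    the part of f on p, see [Pr10_Uop]. *)
Definition Uop : V := \sum_(r <- reps F 0 1) nn r (aa p v).

Let pp : pideal 1 p. Proof. by rewrite -vp. Qed.

Let diagv e d : unit_filtration j e -> ounit d -> pi (G2 e 0 0 d) v = v.
Proof. by move=> ue ud; apply: K1_fixed_diag vK _ ud _; [case: ue|apply: omega_j]. Qed.

Let diag_aa e d w : e != 0 -> d != 0 -> pi (G2 e 0 0 d) (aa p w) =
  aa p (pi (G2 e 0 0 d) w).
Proof. by move=> e0 d0; mxact. Qed.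

Let nn_p x : pideal 1 x -> nn x (aa p v) = aa p v.
Proof.
move=> hx; rewrite nn_aa// (K1_fixed_nn vK)//.
rewrite -(subrr 1); apply: pidealM => //.
by rewrite -vp -lf_valV.
Qed.

Let nn_shift x y : pideal 1 (x - y) -> nn x (aa p v) = nn y (aa p v).
Proof. by move=> hxy; rewrite -[x in LHS](subrK y) (addrC (x - y)) -nnD nn_p. Qed.

Let lw_p c : pideal j%:Z c -> lw c (aa p v) = aa p v.
Proof.
move=> hc; have -> : lw c (aa p v) = aa p (lw (c * p) v) by mxact.
by rewrite (K1_fixed_lw vK)//; apply: pidealW (pidealM hc pp); lia.
Qed.

Let nn_sum (phi : F -> F) : (forall x, pideal 0 x -> pideal 0 (phi x)) ->
  (forall x y, pideal 0 x -> pideal 0 y -> pideal 1 (phi x - phi y) ->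
    pideal 1 (x - y)) ->
  \sum_(r <- reps F 0 1) nn (phi r) (aa p v) = Uop.
Proof.
move=> h1 h2; have r01 := reps_is F 0 1; rewrite add0r in r01.
apply: (reps_sum (f := fun r => nn r (aa p v)) r01 r01) => //.
by move=> x y _ _; apply: nn_shift.
Qed.

Lemma Uop_nn x : pideal 0 x -> nn x Uop = Uop.
Proof.
move=> hx; rewrite {1}/Uop linear_sum /=.
rewrite (eq_bigr (fun r => nn (x + r) (aa p v))); last by move=> r _; rewrite nnD.
apply: nn_sum => [y hy|y z _ _]; first exact: pidealD.
by rewrite opprD addrACA subrr add0r.
Qed.

Lemma Uop_diag e d : unit_filtration j e -> ounit d -> pi (G2 e 0 0 d) Uop = Uop.
Proof.
move=> ue ud; have [e0 ve] := ue.1; have [d0 vd] := ud.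
have [w0 vw] : ounit (e / d) by apply: ounitM; [case: ue|apply: ounitV].
rewrite {1}/Uop linear_sum /=.
rewrite (eq_bigr (fun r => nn ((e / d) * r) (aa p v))); last first.
  move=> r _; have -> : pi (G2 e 0 0 d) (nn r (aa p v)) =
    nn ((e / d) * r) (pi (G2 e 0 0 d) (aa p v)) by mxact.
  by rewrite diag_aa// diagv.
apply: nn_sum => [y hy|y z _ _].
  by apply: pidealMl => //; rewrite -vw.
by rewrite -mulrBr -{1}[1]add0r pideal_mul.
Qed.

(** The factor a(p) improves lower invariance from p^(j+1) to p^j. Passing through n(r) costs a
    diagonal element with entries in 1 + p^j and a change of r inside its class modulo p. *)
Lemma Uop_lw c : (0 < j)%N -> pideal j%:Z c -> lw c Uop = Uop.
Proof.
move=> j0 hc; rewrite /Uop linear_sum /= !big_seq; apply: eq_bigr => r /mem_reps hr.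
have hcr : pideal j%:Z (c * r) by apply: pidealMr.
have u1 := ufiltP j0 hcr; have [[c0 vc] _] := u1.
have cinv := ounit_pideal (ounitV u1.1).
rewrite lw_nn// lw_p; last exact: pidealMr.
rewrite diag_aa ?invr_neq0// diagv; [|exact: ufiltV|by case: u1].
apply: nn_shift; have -> : r / (1 + c * r) - r = - (c * r * (r / (1 + c * r))).
  by field.
apply: pidealN; apply: pidealMr; first by apply: pidealW hcr; lia.
exact: pidealMr.
Qed.

Lemma Uop_fixedS i : j = i.+1 -> K1_fixed j Uop.
Proof.
move=> ji; have j0 : (0 < j)%N by rewrite ji.
rewrite {1}ji; apply: K1_fixedS; rewrite -?ji.
- exact: Uop_nn.
- exact: Uop_diag.
- by move=> c; apply: Uop_lw.
Qed.

(** The q terms of U and the extra one correspond to the points of the projective line over the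
    residue field, which w permutes by r |-> 1/r; U alone lacks the point at infinity. *)
Lemma Tvec_fixed0 : j = 0%N -> K1_fixed 0 (Uop + ww (aa p v)).
Proof.
move=> j0; apply: K1_fixed0.
- move=> x hx; rewrite linearD /= Uop_nn//; congr (_ + _).
  have -> : nn x (ww (aa p v)) = ww (lw x (aa p v)) by mxact.
  by rewrite lw_p// j0.
- move=> e d ue ud; have [e0 ve] := ue; have [d0 vd] := ud.
  have uf t : ounit t -> unit_filtration j t.
    move=> ut; split=> //; rewrite j0.
    by apply: pidealB; [exact: ounit_pideal|exact: pideal1].
  rewrite linearD /= Uop_diag//; last exact: uf.
  congr (_ + _).
  have -> : pi (G2 e 0 0 d) (ww (aa p v)) = ww (aa p (pi (G2 d 0 0 e) v)) by mxact.
  by rewrite diagv//; apply: uf.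
(* Inversion on nonzero classes, made a bijection of o/p by fixing the zero class; its
   representative r0 is split off, since w exchanges that term with the extra one. *)
- pose phi x := if `[<pideal 1 x>] then x else x^-1.
  have [ur _ rc ri] := reps_is F 0 1; rewrite add0r in rc ri.
  have [r0 r0s /pidealN] := rc 0 (@pideal0 F 0); rewrite sub0r opprK => hr0.
  have wphi r : r \in reps F 0 1 -> r != r0 ->
      ww (nn r (aa p v)) = nn (phi r) (aa p v).
    move=> rs rr0; have hr := mem_reps rs.
    have nr1 : ~ pideal 1 r.
      by move=> hr1; move/eqP: rr0; apply; apply: ri => //; apply: pidealB.
    have ur1 := ounitP hr nr1; have [rn0 vr] := ur1.
    rewrite /phi; case: asboolP => // _.
    rewrite ww_nn// lw_p; last by rewrite j0; apply/ounit_pideal/ounitV.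
    rewrite diag_aa ?oppr_eq0 ?invr_neq0// diagv//.
    split; first by apply/ounitN/ounitV.
    rewrite j0; apply: pidealB; last exact: pideal1.
    by apply/ounit_pideal/ounitN/ounitV.
  have phi_sum : \sum_(r <- reps F 0 1) nn (phi r) (aa p v) = Uop.
    apply: nn_sum => [x hx|x y hx hy]; rewrite /phi.
      by case: asboolP => // nx; apply/ounit_pideal/ounitV/ounitP.
    case: asboolP => hx1; case: asboolP => hy1 //.
    - move=> h; case: (ounit_pidealN (ounitV (ounitP hy hy1))).
      by rewrite -(subKr x y^-1); apply: pidealB.
    - move=> h; case: (ounit_pidealN (ounitV (ounitP hx hx1))).
      by rewrite -(subrK y x^-1); apply: pidealD.
    - have [x0 _] := ounitP hx hx1; have [y0 _] := ounitP hy hy1.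
      have -> : x^-1 - y^-1 = - (x^-1 * y^-1 * (x - y)) by field; rewrite ?x0 ?y0.
      move=> /pidealN; rewrite opprK => h.
      have -> : x - y = x * y * (x^-1 * y^-1 * (x - y)) by field; rewrite ?x0 ?y0.
      by apply: pidealMl => //; apply: pidealMl.
  rewrite linearD /= wwK -{2}phi_sum {1}/Uop linear_sum /=.
  rewrite !(bigD1_seq r0)//= nn_p//.
  have -> : phi r0 = r0 by rewrite /phi; case: asboolP.
  rewrite nn_p// [RHS]addrAC [LHS]addrAC [ww _ + _]addrC; congr (_ + _ + _).
  rewrite [LHS]big_seq_cond [RHS]big_seq_cond.
  by apply: eq_bigr => r /andP[rs rr0]; apply: wphi.
Qed.

Lemma Pr10_Uop : aa p (Pr 1 0 v) = q%:R^-1 *: Uop.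
Proof.
rewrite /Pr (Int_eq (g := fun x => nn x v)); last first.
  by move=> x _; rewrite mul0r oppr0 psi0 scale1r.
rewrite (@IntE _ _ _ _ 1); last first.
  move=> x z _ hz; rewrite -nnD (K1_fixed_nn vK)//.
rewrite /avg expr1 linearZ /= linear_sum /=; congr (_ *: _).
rewrite (eq_bigr (fun x => nn (p * x) (aa p v))); last by move=> x _; rewrite aa_nn.
have r01 := reps_is F 0 1; rewrite add0r in r01.
apply: (reps_sum (f := fun r => nn r (aa p v)) (reps_is F (- 1) 1) r01) => //.
- by rewrite !size_reps.
- by move=> x hx; rewrite -(subrr 1); apply: pidealM.
- move=> x y _ _; rewrite -mulrBr.
  by have -> : (1 : int) = 1 + 0 by []; rewrite (pideal_mul 0 _ p0 vp) addNr.
- by move=> x y _ _; apply: nn_shift.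
Qed.

End Hecke.

(** The projection averages n(r) v over p^(-1)/o. For r outside o an element of K_1(p^n) fixes v but
    multiplies n(r) v by omega(u) <> 1, so only the trivial class contributes to the inner product
    with v. *)
Lemma Pr10_ramified n v : (0 < n)%N -> K1_fixed n v ->
  (exists2 u, unit_filtration n.-1 u & omega u != 1) ->
  H (Pr 1 0 v) (Pr 1 0 v) = q%:R^-1 * H v v.
Proof.
move=> n0 vK [u [uu hu] ou]; have [u0 vu] := uu.
rewrite H_Pr /Pr (Int_eq (g := fun x => nn x v)); last first.
  by move=> x _; rewrite mul0r oppr0 psi0 scale1r.
rewrite (@IntE _ _ _ _ 1); last first.
  by move=> x z _ hz; rewrite -nnD (K1_fixed_nn vK).
rewrite /avg expr1 linearZr_LR /= linear_sumr /=.
have -> : (q%:R^-1 : R[i])^* = q%:R^-1 by rewrite fmorphV /= rmorph_nat.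
congr (_ * _).
have [us sJ rc ri] := reps_is F (-1) 1; rewrite addNr in rc ri.
have [r0 r0s] := rc 0 (@pideal0 F _); rewrite sub0r => /pidealN; rewrite opprK => hr0.
rewrite (bigD1_seq r0)//= (K1_fixed_nn vK)// big1_seq ?addr0// => r /andP[rr0 rs].
have hr := mem_reps rs.
have nr : ~ pideal 0 r.
  by move=> hr'; move/eqP: rr0; apply; apply: ri => //; apply: pidealB.
have [rn0 vr] := pidealNP nr.
(* Chosen so that c r + u = 1, which lets [1 0; c u] pass through n(r) as [u 0; c 1]. *)
pose c := (1 - u) / r.
have hc : pideal n%:Z c.
  have -> : n%:Z = (n.-1)%:Z + 1 by lia.
  apply: pidealM; first exact: pidealBC.
  by move=> _; rewrite lf_valV//; have := hr rn0; lia.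
have e1 : pi (G2 1 0 c u) v = v.
  apply: vK; rewrite ?subrr//; try exact: pideal1; try exact: pideal0.
  - exact: ounit_pideal.
  - by rewrite mul1r mul0r subr0.
have e2 : pi (G2 1 0 c u) (nn r v) = omega u *: nn r v.
  have cr : c * r = 1 - u by rewrite divfK.
  have -> : pi (G2 1 0 c u) (nn r v) = nn r (pi (G2 u 0 c 1) v).
    have e : c * r + u = 1 by rewrite cr subrK.
    rewrite /nn !actM; [apply: act_eq; try ring|nz..].
      have -> : 1 * u + r * c = c * r + u by ring.
      by rewrite e; ring.
    by rewrite mulr1 e; ring.
  have -> : pi (G2 u 0 c 1) v = pi (G2 u 0 0 u) (pi (G2 1 0 (c / u) u^-1) v).
    by mxact.
  rewrite act_scalar// linearZ /=; congr (_ *: nn _ _).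
  have uV := ounit_pideal (ounitV uu).
  apply: vK; rewrite ?subrr//; try exact: pideal1; try exact: pideal0.
  - by rewrite mul1r mul0r subr0; apply: ounitV.
  - exact: pidealMr.
have := H_inv (G2 1 0 c u) v (nn r v); rewrite e1 e2 HZr => /eqP.
rewrite -subr_eq0 -{2}[H v _]mul1r -mulrBl mulf_eq0 subr_eq0.
move=> /orP[/eqP h|/eqP//].
by move: ou; rewrite -(conjCK (omega u)) h conjC1 eqxx.
Qed.

(* The part of a newvector supported (in the Kirillov model) on p carries at
   most half of its norm. *)
Lemma newvector_Pr10 n m v : (0 < n)%N -> (m <= n)%N -> K1_fixed n v ->
  (forall i w, (i < n)%N -> K1_fixed i w -> w = 0) ->
  char_conductor omega m -> H (Pr 1 0 v) (Pr 1 0 v) *+ 2 <= H v v.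
Proof.
move=> n0 mn vK new [om omin].
have q2 : (2 : R[i]) <= q%:R by rewrite ler_nat residue_card_gt1.
have q0 : (0 : R[i]) < q%:R by apply: lt_le_trans q2; rewrite ltr0n.
have qV (s : R[i]) : 0 <= s -> q%:R^-1 * s *+ 2 <= s.
  move=> s0; rewrite -mulr_natl mulrA ler_piMl//.
  by rewrite ler_pdivrMr// mul1r.
have [mn'|mn'] := ltnP m n; last first.
  have {mn'}mn : m = n by apply/eqP; rewrite eqn_leq mn.
  rewrite (Pr10_ramified n0 vK); first by apply: qV; apply: H_ge0.
  have [//|h] := pselect (exists2 u, unit_filtration n.-1 u & omega u != 1).
  have /omin : forall u, unit_filtration n.-1 u -> omega u = 1.
    by move=> u hu; have [//|ou] := eqVneq (omega u) 1; case: h; exists u.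
  by rewrite mn; lia.
have [p p0 vp] := exists_val F 1.
have om' u : unit_filtration n.-1 u -> omega u = 1.
  by move=> hu; apply: om; apply: ufiltW hu; lia.
have nn1 : (n <= n.-1.+1)%N by lia.
have Hp : H (Pr 1 0 v) (Pr 1 0 v) = q%:R^-1 ^+ 2 * H (Uop v p) (Uop v p).
  rewrite -(H_inv (G2 p 0 0 1)) -!/(aa _ _) (Pr10_Uop p0 vp vK) HZ.
  by rewrite ger0_norm// invr_ge0 ler0n.
(* For n >= 2, U v is fixed at level n - 1, hence zero. For n = 1 the vanishing vector is U v + w
   a(p) v, so U v has the norm of v and the part on p carries q^(-2) of it. *)
case: n => // -[|i] in n0 mn vK new mn' om' nn1 *; last first.
  have UK := Uop_fixedS p0 vp vK nn1 om' erefl.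
  by rewrite Hp (new _ _ _ UK)// linear0l mulr0 mul0rn H_ge0.
have TK := Tvec_fixed0 p0 vp vK nn1 om' erefl.
have /eqP := new 0%N _ isT TK; rewrite addr_eq0 => /eqP UE.
rewrite Hp UE -scaleN1r HZ normrN1 expr1n mul1r !H_inv expr2 -mulrA.
apply: le_trans (qV _ _); last exact: H_ge0.
rewrite ler_pMn2r// ler_pM2l ?invr_gt0// ler_piMl ?H_ge0// invf_le1//.
by apply: le_trans q2; rewrite ler1n.
Qed.

End Newvectors.

(** * The norm of a newvector against that of its bump *)

Section Bounds.
Variables (R : realType) (F : localField) (D : unitary_whittaker R F).
Local Notation V := (uw_V D).
Local Notation omega := (uw_omega D).
Local Notation ell := (@uw_ell _ _ D).
Local Notation H := (uw_H D).
Local Notation q := (residue_card F).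
Local Notation nn := (@nn _ _ D).
Local Notation aa := (@aa _ _ D).
Implicit Types (x y z t u a b c d : F) (J K L : int) (v w : V) (k n : nat).

Local Notation Pr := (@Pr _ _ D).
Local Notation bump := (@bump _ _ D).
Local Notation K1_fixed := (@K1_fixed _ _ D).
Local Notation separated := (@separated F).

Lemma separated_size J n (s : seq F) : separated (J + n%:Z) s ->
  (forall x, x \in s -> pideal J x) -> (size s <= q ^ n)%N.
Proof.
move=> [us hs] sJ; have [_ _ rc _] := reps_is F J n.
pose rho x := xget 0 [set y | y \in reps F J n /\ pideal (J + n%:Z) (x - y)].
have rhoP x : pideal J x -> rho x \in reps F J n /\ pideal (J + n%:Z) (x - rho x).
  by move=> hx; rewrite /rho; case: xgetP => [y _ //|];
     have [y ys hy] := rc x hx => /(_ y) [].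
rewrite -(size_reps F J n) -(size_map rho); apply: uniq_leq_size.
  rewrite map_inj_in_uniq// => x y xs ys exy; apply: hs => //.
  have -> : x - y = (x - rho x) - (y - rho y) by rewrite exy; ring.
  by apply: pidealB; [case: (rhoP _ (sJ _ xs))|case: (rhoP _ (sJ _ ys))].
by move=> _ /mapP[x xs ->]; case: (rhoP _ (sJ _ xs)).
Qed.

Lemma separated_filter J (P : pred F) (s : seq F) : separated J s ->
  separated J [seq x <- s | P x].
Proof.
move=> [us hs]; split; first exact: filter_uniq.
by move=> x y; rewrite !mem_filter => /andP[_ xs] /andP[_ ys]; apply: hs.
Qed.

Lemma separated_scale J (c : F) (s : seq F) : c != 0 -> separated J s ->
  separated (lf_val c + J) [seq c * x | x <- s].
Proof.
move=> c0 [us hs]; split; first by rewrite map_inj_uniq//; apply: mulfI.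
move=> _ _ /mapP[x xs ->] /mapP[y ys ->]; rewrite -mulrBr pideal_mul// => h.
by rewrite (hs x y).
Qed.

(** Representatives of (1 + p^j) / (1 + p^k). The factor 2 is for j = 0, where there are q^k -
    q^(k-1) of them, at least q^k / 2. *)
Lemma unit_list_exists j k : (0 < k)%N -> (j <= k)%N -> exists s : seq F,
  [/\ separated k%:Z s, forall u, u \in s -> unit_filtration j u &
      (q ^ (k - j) <= 2 * size s)%N].
Proof.
move=> k0 jk; case: j jk => [|j] jk.
  pose inp x := `[<pideal 1 x>].
  have s0 := separated_reps F 0 k; rewrite add0r in s0.
  exists [seq x <- reps F 0 k | ~~ inp x]; split.
  - exact: separated_filter.
  - move=> u; rewrite mem_filter => /andP[/asboolPn hu /mem_reps hu0].
    split; first exact: ounitP.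
    by apply: pidealB => //; exact: pideal1.
  - have h1 : (size [seq x <- reps F 0 k | inp x] <= q ^ k.-1)%N.
      apply: (@separated_size 1).
        have -> : 1 + (k.-1)%:Z = k%:Z by lia.
        exact: separated_filter.
      by move=> x; rewrite mem_filter => /andP[/asboolP].
    have := count_predC inp (reps F 0 k); rewrite size_reps -!size_filter subn0.
    have -> : (q ^ k = q * q ^ k.-1)%N by rewrite -expnS prednK.
    have : (2 * q ^ k.-1 <= q * q ^ k.-1)%N by rewrite leq_mul2r residue_card_gt1 orbT.
    rewrite -[seq.filter (predC _) _]/[seq x <- reps F 0 k | ~~ inp x].
    move: h1; move: (size _) (size _) (q ^ _)%N (q * _)%N => a b Q qQ; lia.
have [us hs] := separated_reps F j.+1%:Z (k - j.+1).
exists [seq 1 + x | x <- reps F j.+1%:Z (k - j.+1)]; split.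
- split; first by rewrite map_inj_uniq//; apply: addrI.
  move=> _ _ /mapP[x xs ->] /mapP[y ys ->].
  have -> : 1 + x - (1 + y) = x - y by ring.
  by move=> h; rewrite (hs x y)//; apply: pidealW h; lia.
- by move=> _ /mapP[x /mem_reps xs ->]; apply: ufiltP.
- by rewrite size_map size_reps; lia.
Qed.

Lemma ell_K1 n v u : K1_fixed n v -> ounit u -> `|ell (aa u v)| = `|ell v|.
Proof.
move=> vK uu; rewrite (K1_fixed_aa vK uu) ellZ normrM omega_norm ?mul1r//.
by case: uu.
Qed.

Lemma Pr_unit_part k v : (0 < k)%N -> (forall x, pideal 0 x -> nn x v = v) ->
  v - Pr 1 0 v = \sum_(r <- [seq x <- reps F 0 k | ~~ `[<pideal 1 x>]]) Pr k r v.
Proof.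
move=> k_gt0 hN; pose inp x := `[<pideal 1 x>].
have vsum : v = \sum_(r <- reps F 0 k) Pr k r v.
  rewrite -[LHS](@Pr_id _ _ _ 0 0); last first.
    by move=> x hx; rewrite mul0r psi0 scale1r hN.
  rewrite -(Pr_sum 0 k) add0r; apply: eq_bigr => r _.
  by rewrite !add0r.
have psum : Pr 1 0 v = \sum_(r <- reps F 0 k | inp r) Pr k r v.
  rewrite {1}vsum linear_sum [RHS]big_mkcond; apply: eq_bigr => r _ /=.
  rewrite -Pr_comm /inp; case: asboolP => hr.
    by rewrite Pr_Pr// ?subr0.
  by rewrite Pr_Pr0// subr0.
by rewrite psum {1}vsum (bigID inp) /= [LHS]addrC addKr big_filter.
Qed.

Section NewvectorNorm.
Variables (n k : nat) (v : V).
Hypothesis k_gt0 : (0 < k)%N.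
Hypothesis omega_k : forall u, unit_filtration k u -> omega u = 1.
Hypothesis v_k : forall u, unit_filtration k u -> aa u v = v.
Hypothesis vK : K1_fixed n v.
Hypothesis ell_v : ell v = 1.

(** The reference vector xi is cut out of the newvector itself; ell v = 1 makes it normalized. *)
Definition bumpv := Pr k 1 v.

Let xi_bump : bump k bumpv. Proof. exact: Pr_bump. Qed.
Let ell_xi : ell bumpv = 1. Proof. by rewrite ell_Pr. Qed.

Lemma bumpv_gt0 : 0 < H bumpv bumpv.
Proof.
rewrite dnorm_gt0; apply/eqP => e; have /eqP := ell_xi.
by rewrite e -(scale0r 0) ellZ mul0r eq_sym oner_eq0.
Qed.

(** On units |W(a(u))| = 1, so each of at least q^k / 2 unit balls contributes H(xi, xi). *)
Lemma newvector_norm_ge : q%:R ^+ k * H bumpv bumpv <= H v v *+ 2.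
Proof.
have [s [ss su hs]] := unit_list_exists k_gt0 (leq0n k).
have := kirillov_bessel (s := s) (J := 0) k_gt0 omega_k xi_bump ell_xi v_k.
rewrite addr0 => /(_ ss (fun u us => (su u us).1)).
rewrite (eq_big_seq (fun=> 1)).
  rewrite big_const_seq count_predT iter_addr_0 => h.
  apply: le_trans (ler_wMn2r 2 h); rewrite -mulrnAl.
  rewrite ler_pM2r ?bumpv_gt0// -mulrnA -natrX ler_nat.
  by rewrite subn0 in hs; rewrite mulnC.
by move=> u us; rewrite (ell_K1 vK (su u us).1) ell_v normr1 expr1n.
Qed.

(** The unit part consists of at most q^k balls of norm H(xi, xi), and by hypothesis it carries at
    least half of the norm. *)
Lemma newvector_norm_le : H (Pr 1 0 v) (Pr 1 0 v) *+ 2 <= H v v ->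
  H v v <= q%:R ^+ k * H bumpv bumpv *+ 2.
Proof.
move=> hP; pose inp x := `[<pideal 1 x>].
have dsum := Pr_unit_part k_gt0 (fun x => K1_fixed_nn (x := x) vK).
have ss : separated (k%:Z + 0) [seq x <- reps F 0 k | ~~ inp x].
  by apply: separated_filter; rewrite addrC; apply: separated_reps.
have su u : u \in [seq x <- reps F 0 k | ~~ inp x] -> ounit u.
  by rewrite mem_filter => /andP[/asboolPn hu /mem_reps hu0]; apply: ounitP.
have dn : H (v - Pr 1 0 v) (v - Pr 1 0 v) <= q%:R ^+ k * H bumpv bumpv.
  rewrite dsum Pr_sum_norm; last by rewrite -[k%:Z]addr0.
  rewrite (eq_big_seq (fun=> H bumpv bumpv)); last first.
    move=> u /su uu; have [u0 vu] := uu.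
    have := Pr_kirillov_norm k_gt0 omega_k xi_bump ell_xi u0 v_k.
    rewrite vu addr0 => ->.
    by rewrite (ell_K1 vK uu) ell_v normr1 expr1n mul1r.
  rewrite big_const_seq count_predT iter_addr_0 -[leLHS]mulr_natl ler_pM2r ?bumpv_gt0//.
  rewrite -natrX ler_nat -(size_reps F 0 k) size_filter.
  exact: count_size.
have vn : H v v = H (Pr 1 0 v) (Pr 1 0 v) + H (v - Pr 1 0 v) (v - Pr 1 0 v).
  rewrite -H_orthD; first by rewrite addrC subrK.
  by rewrite HC linearBl /= H_Pr subrr conjC0.
have : H v v *+ 2 <= H v v + q%:R ^+ k * H bumpv bumpv *+ 2.
  by rewrite {1}vn mulrnDl; apply: lerD => //; apply: ler_wMn2r.
by rewrite mulr2n lerD2l.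
Qed.

End NewvectorNorm.

End Bounds.

(** * Both bounds at positive level *)

Section SupBounds.
Variables (R : realType) (F : localField) (D : unitary_whittaker R F).
Local Notation psi := (uw_psi D).
Local Notation V := (uw_V D).
Local Notation pi := (@uw_pi _ _ D).
Local Notation omega := (uw_omega D).
Local Notation ell := (@uw_ell _ _ D).
Local Notation H := (uw_H D).
Local Notation q := (residue_card F).
Local Notation nn := (@nn _ _ D).
Local Notation aa := (@aa _ _ D).
Local Notation lw := (@lw _ _ D).
Implicit Types (x y z t u a b c d : F) (J K L : int) (v w : V) (k n : nat).

Local Notation Pr := (@Pr _ _ D).
Local Notation K1_fixed := (@K1_fixed _ _ D).

Lemma omega1 : omega 1 = 1.
Proof.
have [[v v0] _] := uw_irr D; have := act1 v.
rewrite act_scalar ?oner_neq0// => /eqP; rewrite -{2}[v]scale1r -subr_eq0 -scalerBl.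
by rewrite scaler_eq0 (negPf v0) orbF subr_eq0 => /eqP.
Qed.

(** The factorization with a lower unipotent needs c/d integral. When it is not, n(1), which fixes
    v, replaces d by c + d, and c/(c + d) is a unit. *)
Lemma ell_iwasawa n v g : K1_fixed n v -> exists y c,
  [/\ y != 0, pideal 0 c & `|ell (pi g v)| = `|ell (aa y (lw c v))|].
Proof.
move=> vK; have [a [b [c [d [det0 -> _]]]]] := G2P g.
have good a' b' c' d' : a' * d' - b' * c' != 0 -> d' != 0 -> pideal 0 (c' / d') ->
    exists y e, [/\ y != 0, pideal 0 e &
      `|ell (pi (G2 a' b' c' d') v)| = `|ell (aa y (lw e v))|].
  move=> det' d0' hcd; exists ((a' * d' - b' * c') / d' ^+ 2), (c' / d').
  split=> //; first by rewrite mulf_neq0 ?invr_neq0 ?expf_neq0.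
  rewrite bruhat_lower// ell_nn normrM psi_norm mul1r.
  have -> w : pi (G2 ((a' * d' - b' * c') / d') 0 0 d') w =
      pi (G2 d' 0 0 d') (aa ((a' * d' - b' * c') / d' ^+ 2) w) by mxact.
  by rewrite act_scalar// ellZ normrM omega_norm// mul1r.
have [d0|d0] := eqVneq d 0.
  have c0 : c != 0.
    by apply: contraNneq det0 => ->; rewrite d0 !mulr0 subrr.
  have -> : pi (G2 a b c d) v = pi (G2 a (a + b) c (c + d)) v.
    rewrite -{1}(K1_fixed_nn vK (@pideal1 F)); mxact.
  apply: good; rewrite d0 addr0 ?divff//; last exact: pideal1.
  have -> : a * c - (a + b) * c = a * d - b * c by rewrite d0; ring.
  by [].
have [hcd|/pidealNP[cd0 vcd]] := pselect (pideal 0 (c / d)); first exact: good.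
have c0 : c != 0 by apply: contraNneq cd0 => ->; rewrite mul0r.
have -> : pi (G2 a b c d) v = pi (G2 a (a + b) c (c + d)) v.
  rewrite -{1}(K1_fixed_nn vK (@pideal1 F)); mxact.
have [u0 vu] : ounit (1 + d / c).
  apply: ounitD; first exact: ounit1.
  move=> _; rewrite -invf_div lf_valV//; lia.
have dcE : c + d = c * (1 + d / c) by field.
apply: good.
- by have -> : a * (c + d) - (a + b) * c = a * d - b * c by ring.
- by rewrite dcE mulf_neq0.
- have -> : c / (c + d) = (1 + d / c)^-1.
    by rewrite dcE invfM mulrA divff// mul1r.
  by apply/ounit_pideal/ounitV.
Qed.

Section Torus.
Variables (n l : nat) (v : V) (c : F).
Hypothesis vK : K1_fixed n v.
Hypothesis ln : (l <= n)%N.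
Hypothesis c_o : pideal l%:Z c.

(** Conjugating n(x) a(a) by [1 0; c 1] gives a matrix with upper left entry z = a + c x and lower
    left entry c (1 - z); the congruence puts it in z K_1(p^n). *)
Lemma lw_torus x a : pideal 0 x -> ounit a -> ounit (a + c * x) ->
  pideal (n - l)%:Z (1 - a - c * x) ->
  nn x (aa a (lw c v)) = omega (a + c * x) *: lw c v.
Proof.
move=> hx ua uz he; have [z0 _] := uz; have [a0 _] := ua.
set z := a + c * x in uz z0 *.
set e := 1 - a - c * x in he *.
have D0 : z * (1 - c * x) - x * (c * e) != 0.
  by have -> : z * (1 - c * x) - x * (c * e) = a by rewrite /z /e; ring.
have D1 : 1 * ((1 - c * x) / z) - x / z * (c * e / z) = a * (z^-1 * z^-1).
  have -> : 1 * ((1 - c * x) / z) - x / z * (c * e / z) =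
      (z * (1 - c * x) - x * (c * e)) * (z^-1 * z^-1) by field.
  by congr (_ * _); rewrite /z /e; ring.
have D2 : (1 - c * x) / z - x / z * (c * e / z) != 0.
  by rewrite -[(1 - c * x) / z]mul1r D1 !mulf_neq0 ?invr_neq0.
have -> : nn x (aa a (lw c v)) = lw c (pi (G2 z x (c * e) (1 - c * x)) v).
  by rewrite /lw /nn /aa !actM; [apply: act_eq; rewrite /z /e; ring|nz..].
have -> : pi (G2 z x (c * e) (1 - c * x)) v = pi (G2 z 0 0 z)
    (pi (G2 1 (x / z) (c * e / z) ((1 - c * x) / z)) v).
  by rewrite !actM; [apply: act_eq; field|nz..].
rewrite act_scalar// linearZ /=; congr (_ *: lw _ _).
have zV := ounit_pideal (ounitV uz).
have co : pideal 0 c by apply: pidealW c_o; lia.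
apply: vK; rewrite ?subrr.
- exact: pideal1.
- exact: pidealMr.
- by apply: pidealMr => //; apply: pidealB; [exact: pideal1|exact: pidealMl].
- by rewrite D1; apply: ounitM => //; apply: ounitM; apply: ounitV.
- exact: pideal0.
- apply: pidealMr => //.
  have -> : n%:Z = l%:Z + (n - l)%:Z by lia.
  exact: pidealM.
Qed.

End Torus.

(** Take a = u in [lw_torus]. The choice x = 0 works for u in 1 + p^(n-l); x = (1 - u)/c works for u
    in 1 + p^l, and n(x) then contributes only a value of psi. One of l and n - l is at most n/2. *)
Lemma ell_lw_invariant n v c : (0 < n)%N -> K1_fixed n v -> pideal 0 c ->
  exists2 j, (j <= n./2)%N & forall y u, unit_filtration j u -> y != 0 ->
    `|ell (aa (y * u) (lw c v))| = `|ell (aa y (lw c v))|.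
Proof.
move=> n0 vK hc.
have [l [ln cl lP]] : exists l, [/\ (l <= n)%N, pideal l%:Z c &
    l = n \/ c != 0 /\ lf_val c = l%:Z].
  have [hcn|/pidealNP[c0 vc]] := pselect (pideal n%:Z c); first by exists n; split; [|exact: hcn|left].
  have := hc c0; case: (lf_val c) (@pideal_val F c) vc => // l hl ? _.
  exists l; split => //; first by lia.
  by right; split => //.
exists (minn l (n - l)); first by rewrite -divn2; lia.
move=> y u uu y0; have [[u0 vu] hu] := uu.
have [lln|nll] := leqP (n - l) l.
  have := lw_torus vK ln cl (@pideal0 F 0) uu.1.
  rewrite mulr0 addr0 subr0 nn0 => /(_ uu.1) hT.
  rewrite -aaM// hT; last by apply: pidealBC; apply: pidealW hu; lia.
  by rewrite linearZ ellZ normrM omega_norm// mul1r.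
have [c0 vc] : c != 0 /\ lf_val c = l%:Z by case: lP => // e; move: nll; lia.
pose x := (1 - u) / c.
have cx : c * x = 1 - u by rewrite mulrC divfK.
have hx : pideal 0 x.
  rewrite -(subrr l%:Z).
  apply: pidealM; first by apply: pidealBC; apply: pidealW hu; lia.
  by move=> _; rewrite lf_valV// vc.
have := lw_torus vK ln cl hx uu.1; rewrite cx addrC subrK => /(_ (ounit1 F)).
have -> : 1 - u - (1 - u) = 0 :> F by ring.
move=> /(_ (@pideal0 F _)) hT.
rewrite -[in RHS](scale1r (lw c v)) -omega1 -hT aa_nn// ell_nn normrM psi_norm mul1r.
by rewrite aaM.
Qed.

Lemma common_level (m n : nat) (v w : V) : char_conductor omega m ->
  exists k, [/\ (n < k)%N, forall u, unit_filtration k u -> omega u = 1,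
    forall u, unit_filtration k u -> aa u v = v &
    forall u, unit_filtration k u -> aa u w = w].
Proof.
move=> [om _]; have [k1 _ h1] := smooth_aa v; have [k2 _ h2] := smooth_aa w.
exists (n + m + k1 + k2).+1; split; first by lia.
- by move=> u hu; apply: om; apply: ufiltW hu; lia.
- by move=> u hu; apply: h1; apply: ufiltW hu; lia.
- by move=> u hu; apply: h2; apply: ufiltW hu; lia.
Qed.

(** At least q^(k-j) / 2 disjoint balls y u carry the same |W|^2, while the total norm is at most 2
    q^k H(xi, xi); the two factors 2 give the 4. *)
Lemma sup_upper n m v g : (0 < n)%N -> (m <= n)%N -> K1_fixed n v -> ell v = 1 ->
  (forall i w, (i < n)%N -> K1_fixed i w -> w = 0) -> char_conductor omega m ->
  `|ell (pi g v)| ^+ 2 <= 4 * q%:R ^+ n./2.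
Proof.
move=> n0 mn vK ev new om.
have [y [c [y0 hc ->]]] := ell_iwasawa g vK.
set v' := lw c v.
have [k [nk ok vk vk']] := common_level n v v' om.
have k0 : (0 < k)%N by lia.
have hle := newvector_norm_le k0 ok vk vK ev (newvector_Pr10 n0 mn vK new om).
have xi0 := bumpv_gt0 k ev.
have [j hj jinv] := ell_lw_invariant n0 vK hc.
have jk : (j <= k)%N by move: hj; rewrite -divn2; lia.
have [s [ss su hs]] := unit_list_exists F k0 jk.
have := kirillov_bessel (s := [seq y * u | u <- s]) (J := lf_val y) k0 ok
  (Pr_bump k0 vk) (etrans (ell_Pr k v) ev) vk'.
rewrite addrC => /(_ (separated_scale y0 ss)) hb.
have {hb} : (\sum_(u <- s) `|ell (aa y v')| ^+ 2) * H (bumpv k v) (bumpv k v) <= H v v.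
  have -> : H v v = H v' v' by rewrite /v' H_inv.
  apply: le_trans (hb _); last first.
    move=> _ /mapP[u /su[[u0 vu] _] ->]; rewrite mulf_neq0// lf_valM_neq0// vu.
    by rewrite addr0.
  rewrite ler_pM2r// big_map !big_seq; apply: ler_sum => u /su hu.
  by rewrite jinv.
rewrite big_const_seq count_predT iter_addr_0 => h1.
have {h1} := le_trans h1 hle; rewrite -mulrnAl ler_pM2r// => h1.
set W := `|_| ^+ 2 in h1 *.
have W0 : 0 <= W by rewrite exprn_ge0.
have qkj : (0 : R[i]) < q%:R ^+ (k - j).
  by rewrite exprn_gt0// ltr0n; have := residue_card_gt1 F; lia.
rewrite -(ler_pM2r qkj) -[leRHS]mulrA -exprD.
apply: (@le_trans _ _ (W *+ (2 * size s))).
  by rewrite -[leRHS]mulr_natr ler_wpM2l// -natrX ler_nat.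
rewrite mulnC mulrnA; apply: le_trans (ler_wMn2r 2 h1) _.
rewrite -mulrnA -[leLHS]mulr_natl ler_pM2l ?ltr0n//.
by apply: ler_weXn2l; [rewrite ler1n; have := residue_card_gt1 F; lia|lia].
Qed.

(* For c of valuation l = ceil(n/2) the central character forces the translate
   of the newvector by [1 0; c 1] to be supported, in the Kirillov model, on a
   single coset b + o with v(b) = l - m. *)
Lemma translate_support n m v c : (0 < n)%N -> (m <= n)%N -> K1_fixed n v ->
  v != 0 -> char_conductor omega m -> (uphalf n < m)%N -> c != 0 ->
  lf_val c = (uphalf n)%:Z ->
  exists b, [/\ b != 0, lf_val b = (uphalf n)%:Z - m%:Z & Pr 0 b (lw c v) = lw c v].
Proof.
set l := uphalf n => n0 mn vK v0 [om omin] lm c0 vc.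
have ln : (l <= n)%N by rewrite /l uphalf_half -divn2; lia.
have l0 : (0 < l)%N by rewrite /l uphalf_half -divn2; lia.
(* This is what the ceiling is for: elements of 1 + p^l then meet the congruence of [lw_torus] with
   x = 0. *)
have nl : (n - l <= l)%N by rewrite /l uphalf_half -divn2; lia.
have cl : pideal l%:Z c by move=> _; rewrite vc.
have cx x : pideal 0 x -> unit_filtration l (1 - c * x).
  by move=> hx; apply: ufiltP => //; apply/pidealN/pidealMr.
set v' := lw c v.
have v'0 : v' != 0.
  by apply: contraNneq v0 => e; rewrite -(lw0 v) -(addNr c) -lwD -/v' e linear0.
have aav u : unit_filtration l u -> aa u v' = omega u *: v'.
  move=> uu; have := lw_torus vK ln cl (@pideal0 F 0) uu.1.
  rewrite mulr0 addr0 subr0 nn0; apply; first exact: uu.1.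
  by apply: pidealBC; apply: pidealW uu.2; lia.
have nnv x : pideal 0 x -> nn x v' = (omega (1 - c * x))^-1 *: v'.
  move=> hx; have ux := cx x hx; have [u0 _] := ux.1.
  have := lw_torus vK ln cl hx ux.1.
  rewrite subrK => /(_ (ounit1 F)).
  have -> : 1 - (1 - c * x) - c * x = 0 by ring.
  move=> /(_ (@pideal0 F _)); rewrite omega1 scale1r -/v' aav// linearZ /= => {2}<-.
  by rewrite scalerA mulVf ?scale1r// -normr_eq0 omega_norm ?oner_neq0.
pose r := (m - l)%N.
(* For x in p^r the element 1 - c x lies in 1 + p^m, where omega is trivial; so n(p^r) fixes v',
   which is thus supported on p^(-r). *)
have vsum : \sum_(b <- reps F (- r%:Z) r) Pr 0 b v' = v'.
  have h := Pr_sum (- r%:Z) r 0 v'; rewrite addNr in h.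
  rewrite -[RHS](@Pr_id _ _ _ (- r%:Z) 0).
    by rewrite -h; apply: eq_bigr => b _; rewrite add0r.
  move=> x; rewrite opprK => hx.
  rewrite mul0r psi0 scale1r nnv; last by apply: pidealW hx; lia.
  rewrite om ?invr1 ?scale1r//; apply: ufiltP; first by lia.
  by apply: pidealN; apply: pidealW (pidealM cl hx); rewrite /r; lia.
have [b hb Pb] : exists2 b, pideal (- r%:Z) b & Pr 0 b v' != 0.
  have [//|h] := pselect (exists2 b, pideal (- r%:Z) b & Pr 0 b v' != 0).
  move: v'0; rewrite -vsum big1_seq ?eqxx// => b /andP[_ /mem_reps hb].
  by have [//|Pb] := eqVneq (Pr 0 b v') 0; case: h; exists b.
have theta x : pideal 0 x -> (omega (1 - c * x))^-1 = psi (b * x).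
  move=> hx; have := Pr_eigen (J := 0) b v' hx; rewrite Pr_nnl nnv// linearZ /=.
  by move/eqP; rewrite -subr_eq0 -scalerBl scaler_eq0 (negPf Pb) orbF subr_eq0 => /eqP.
(* Otherwise [theta] would make omega trivial on 1 + p^(m-1), against the minimality of m. *)
have bN : ~ pideal (1 - r%:Z) b.
  move=> hb'; have /omin : forall u, unit_filtration m.-1 u -> omega u = 1.
    move=> u [uu hu]; pose x := (1 - u) / c.
    have hx : pideal (r%:Z - 1) x.
      have -> : r%:Z - 1 = (m.-1)%:Z + - l%:Z by rewrite /r; lia.
      apply: pidealM; first exact: pidealBC.
      by move=> _; rewrite lf_valV// vc.
    have ux : u = 1 - c * x by rewrite /x mulrCA divff// mulr1 subKr.
    apply: invr_inj; rewrite invr1 ux theta; last by apply: pidealW hx; rewrite /r; lia.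
    apply: psi_o; rewrite -(subrr (1 - r%:Z)).
    by apply: pidealM => //; apply: pidealW hx; lia.
  by lia.
have [b0 vb] := pidealNP bN.
exists b; split=> //; first by have := hb b0; move: vb; rewrite /r; lia.
by apply: Pr_id => x; rewrite oppr0 => hx; rewrite nnv// theta.
Qed.

(** The coset b + o, with v(b) = -r, is a union of only q^(k-r) balls b' (1 + p^k), so the norm is
    at most q^(k-r) B H(xi, xi); yet it is at least q^k H(xi, xi) / 2. *)
Lemma sup_lower n m v (B : R[i]) : (0 < n)%N -> (m <= n)%N -> K1_fixed n v ->
  ell v = 1 -> char_conductor omega m -> (uphalf n < m)%N ->
  (forall g, `|ell (pi g v)| ^+ 2 <= B) -> q%:R ^+ (m - uphalf n) <= B *+ 2.
Proof.
move=> n0 mn vK ev om lm hB.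
have v0 : v != 0.
  by apply: contra_eq_neq ev => ->; rewrite -(scale0r 0) ellZ mul0r eq_sym oner_eq0.
have [c c0 vc] := exists_val F (uphalf n)%:Z.
have [b [b0 vb Pb]] := translate_support n0 mn vK v0 om lm c0 vc.
set v' := lw c v in Pb; pose r := (m - uphalf n)%N.
have [k [nk ok vk vk']] := common_level n v v' om.
have k0 : (0 < k)%N by lia.
have hge := newvector_norm_ge k0 ok vk vK ev.
have xi0 := bumpv_gt0 k ev.
have := kirillov_parseval (s := [seq b + x | x <- reps F 0 (k - r)])
  (J := lf_val b) k0 ok (Pr_bump k0 vk) (etrans (ell_Pr k v) ev) vk'.
have kb : k%:Z + lf_val b = 0 + (k - r)%:Z by rewrite vb /r; lia.
rewrite kb => hp.
have {hp} vE : H v v = (\sum_(x <- reps F 0 (k - r)) `|ell (aa (b + x) v')| ^+ 2)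
    * H (bumpv k v) (bumpv k v).
  have -> : H v v = H v' v' by rewrite /v' H_inv.
  rewrite hp ?big_map//; first last.
  - by rewrite -[RHS]Pb -(Pr_sum 0 (k - r)).
  - move=> _ /mapP[x /mem_reps hx ->].
    have hbx : b + x = b * (1 + x / b) by field.
    have [u0 vu] : ounit (1 + x / b).
      apply: ounitD; first exact: ounit1.
      apply: (@pidealW _ (0 + - lf_val b)); first by rewrite vb; lia.
      by apply: pidealM => // _; rewrite lf_valV.
    by rewrite hbx mulf_neq0// lf_valM_neq0// vu addr0.
  - have [us hs] := separated_reps F 0 (k - r).
    split; first by rewrite map_inj_uniq//; apply: addrI.
    move=> _ _ /mapP[x xs ->] /mapP[y ys ->].
    have -> : b + x - (b + y) = x - y by ring.
    by move=> h; rewrite (hs x y).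
have vB : H v v <= q%:R ^+ (k - r) * B * H (bumpv k v) (bumpv k v).
  rewrite vE ler_pM2r// -natrX -(size_reps F 0 (k - r)).
  rewrite mulr_natl -iter_addr_0 -(count_predT (reps F 0 (k - r))) -big_const_seq.
  apply: ler_sum => x _.
  by rewrite /v' /aa /lw -actG; apply: hB.
have := le_trans hge (ler_wMn2r 2 vB).
rewrite -mulrnAl ler_pM2r// -mulrnAr => h.
have qkr : (0 : R[i]) < q%:R ^+ (k - r).
  by rewrite exprn_gt0// ltr0n; have := residue_card_gt1 F; lia.
rewrite -(ler_pM2l qkr) -exprD; apply: le_trans h.
by rewrite le_eqVlt; apply/orP; left; apply/eqP; congr (_ ^+ _); rewrite /r; lia.
Qed.

End SupBounds.

(** * Level 0: the spherical vector *)

(** For [a t] = W(a(p^(t-1))) and [f t] = H(a(p^t) v, v): two solutions of one recurrence, linked by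
    [rel]. Bounding f by h gives |a(t+2)| <= (q (q + 1) + 2) / q^2, and this is at most 2 since (q -
    2) (q + 1) >= 0. Satake parameters never appear. *)
Lemma hecke_recurrence_bound (K : numFieldType) (q lam om h : K) (a f : nat -> K) :
  2 <= q -> 0 < h -> `|om| = 1 -> a 0%N = 0 -> a 1%N = 1 -> f 0%N = h ->
  lam * h = (q + 1) * f 1%N ->
  (forall t, lam * a t.+1 = q * a t.+2 + om * a t) ->
  (forall t, lam * f t.+1 = q * f t.+2 + om * f t) ->
  (forall t, `|f t| <= h) -> forall t, `|a t| <= 2.
Proof.
move=> q2 h0 om1 a0 a1 f0 lamh ra rf fh.
have q0 : 0 < q by apply: lt_le_trans q2; rewrite ltr0n.
have qn0 : q != 0 by rewrite gt_eqF.
have rel t : h * q ^+ 2 * a t.+2 = q * (q + 1) * f t.+1 + om * h * a t.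
  suff : (h * q ^+ 2 * a t.+2 = q * (q + 1) * f t.+1 + om * h * a t) /\
         (h * q ^+ 2 * a t.+3 = q * (q + 1) * f t.+2 + om * h * a t.+1) by case.
  have a2 : q * a 2%N = lam by have := ra 0%N; rewrite a0 a1 mulr0 addr0 mulr1.
  elim: t => [|t [IH1 IH2]].
    split.
      have -> : h * q ^+ 2 * a 2%N = q * (h * (q * a 2%N)) by ring.
      by rewrite a0 a2 [h * _]mulrC lamh; ring.
    have -> : h * q ^+ 2 * a 3%N = h * q * (q * a 3%N) by ring.
    have -> : q * a 3%N = lam * a 2%N - om by rewrite ra a1; ring.
    have -> : q * (q + 1) * f 2%N = (q + 1) * (q * f 2%N) by ring.
    have -> : q * f 2%N = lam * f 1%N - om * h by rewrite rf f0; ring.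
    have -> : h * q * (lam * a 2%N - om) = h * lam * (q * a 2%N) - h * q * om by ring.
    have -> : (q + 1) * (lam * f 1%N - om * h) =
      lam * ((q + 1) * f 1%N) - (q + 1) * om * h by ring.
    by rewrite a2 -lamh a1; ring.
  split=> //; apply: (mulfI qn0).
  have -> : q * (h * q ^+ 2 * a t.+4) = h * q ^+ 2 * (q * a t.+4) by ring.
  have -> : q * a t.+4 = lam * a t.+3 - om * a t.+2 by rewrite ra; ring.
  have -> : h * q ^+ 2 * (lam * a t.+3 - om * a t.+2) =
    lam * (h * q ^+ 2 * a t.+3) - om * (h * q ^+ 2 * a t.+2) by ring.
  rewrite IH1 IH2.
  have -> : q * (q * (q + 1) * f t.+3 + om * h * a t.+2) =
    q * (q + 1) * (q * f t.+3) + om * h * (q * a t.+2) by ring.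
  have -> : q * f t.+3 = lam * f t.+2 - om * f t.+1 by rewrite rf; ring.
  have -> : q * a t.+2 = lam * a t.+1 - om * a t by rewrite ra; ring.
  by ring.
have step t : `|a t| <= 2 -> `|a t.+2| <= 2.
  move=> at2; have hq : 0 < h * q ^+ 2 by rewrite mulr_gt0 ?exprn_gt0.
  rewrite -(ler_pM2l hq) -{1}(gtr0_norm hq) -normrM rel.
  apply: le_trans (ler_normD _ _) _; rewrite !normrM om1 mul1r.
  have q1 : 0 < q + 1 by rewrite addr_gt0.
  rewrite (gtr0_norm q0) (gtr0_norm h0) (gtr0_norm q1).
  apply: (@le_trans _ _ (q * (q + 1) * h + h * 2)).
    by apply: lerD; rewrite ler_pM2l// mulr_gt0.
  have -> : q * (q + 1) * h + h * 2 = h * (q ^+ 2 + q + 2) by ring.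
  rewrite -mulrA ler_pM2l// -subr_ge0.
  have -> : q ^+ 2 * 2 - (q ^+ 2 + q + 2) = (q - 2) * (q + 1) by ring.
  by rewrite mulr_ge0 ?subr_ge0// ltW.
move=> t; suff : `|a t| <= 2 /\ `|a t.+1| <= 2 by case.
elim: t => [|t [h1 h2]]; last by split=> //; apply: step.
by rewrite a0 a1 normr0 normr1 ler0n ler1n.
Qed.

Section Spherical.
Variables (R : realType) (F : localField) (D : unitary_whittaker R F).
Local Notation psi := (uw_psi D).
Local Notation V := (uw_V D).
Local Notation pi := (@uw_pi _ _ D).
Local Notation omega := (uw_omega D).
Local Notation ell := (@uw_ell _ _ D).
Local Notation H := (uw_H D).
Local Notation q := (residue_card F).
Local Notation nn := (@nn _ _ D).
Local Notation aa := (@aa _ _ D).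
Local Notation lw := (@lw _ _ D).
Local Notation ww := (ww D).
Implicit Types (x y z t u a b c d : F) (J K L : int) (v w : V) (k n : nat).

Local Notation Pr := (@Pr _ _ D).
Local Notation K1_fixed := (@K1_fixed _ _ D).

Lemma nn_fixed_eq0 w : K1_fixed 0 w -> (forall x, nn x w = w) -> w = 0.
Proof.
move=> wK wN; apply: uw_ell_inj => g.
have [y [c [y0 hc e]]] := ell_iwasawa g wK.
apply/eqP; rewrite -normr_eq0 e (K1_fixed_lw wK hc) normr_eq0.
case: (uw_psiP D) => _ _ _ [x _ psx].
have := ell_nn x (aa y w); rewrite nn_aa// wN => /eqP.
rewrite -subr_eq0 -{1}[ell _]mul1r -mulrBl mulf_eq0 subr_eq0 eq_sym (negPf psx).
by rewrite orFb.
Qed.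

(** In SL_2 the matrix diag(x, 1/x) is a product of n(x), a lower unipotent with entry -1/x in p,
    n(x) again, and a Weyl element. *)
Lemma K1_fixed0_large w x : x != 0 -> K1_fixed 0 w -> lf_val x = -1 ->
  nn x w = w -> pi (G2 x 0 0 x^-1) w = w.
Proof.
move=> x0 wK vx hx.
have k1 : pi (G2 0 (-1) 1 0) w = w.
  apply: wK; try exact: pideal0.
  - by apply: pidealN; apply: pideal1.
  - by rewrite mul0r mulr1 sub0r opprK; apply: ounit1.
  - by rewrite sub0r; apply: pidealN; apply: pideal1.
  - exact: pideal1.
have k2 : lw (- x^-1) w = w.
  by apply: (K1_fixed_lw wK) => _; rewrite lf_valN lf_valV// vx.
have -> : pi (G2 x 0 0 x^-1) w =
    nn x (lw (- x^-1) (nn x (pi (G2 0 (-1) 1 0) w))).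
  have S : x * - x^-1 = -1 by rewrite mulrN divff.
  rewrite /nn /aa /lw ?actM; [apply: act_eq; field; nz|nz..].
    by rewrite S subrr !mul0r !add0r S opprK oner_neq0.
  by rewrite S subrr sub0r opprK oner_neq0.
by rewrite k1 hx k2 hx.
Qed.

Lemma K1_fixed0_eq0 w : K1_fixed 0 w -> Pr 1 0 w = w -> w = 0.
Proof.
move=> wK wP; apply: nn_fixed_eq0 => // x.
have [p p0 vp] := exists_val F (-1).
have hN y : pideal (-1) y -> nn y w = w.
  by move=> hy; rewrite -wP Pr_eigen// mul0r psi0 scale1r.
have hp : pi (G2 p 0 0 p^-1) w = w.
  by apply: K1_fixed0_large => //; apply: hN; rewrite -vp.
have main i y : pideal (- (i%:Z *+ 2) - 1) y -> nn y w = w.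
  elim: i y => [|i IH] y hy; first by apply: hN; rewrite mul0rn oppr0 sub0r in hy.
  have -> : nn y w = pi (G2 p 0 0 p^-1) (nn (y / p ^+ 2) (pi (G2 p^-1 0 0 p) w)).
    by mxact.
  have -> : pi (G2 p^-1 0 0 p) w = w by rewrite -{1}hp -[RHS]act1; mxact.
  rewrite IH// /=.
  have -> : - (i%:Z *+ 2) - 1 = (- (i.+1%:Z *+ 2) - 1) + 2 by rewrite !mulr2n; lia.
  apply: pidealM => // _; rewrite lf_valV ?expf_neq0// expr2 lf_valM_neq0// vp.
  by lia.
apply: (main `|lf_val x|%N); apply: pidealW (@pideal_val F x).
by rewrite mulr2n; lia.
Qed.

Lemma K1_fixedB n (a : R[i]) v w : K1_fixed n v -> K1_fixed n w ->
  K1_fixed n (v - a *: w).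
Proof. by move=> hv hw ? ? ? ? *; rewrite linearB linearZ /= hv// hw. Qed.

Section SphericalVector.
Variables (v : V).
Hypothesis vK : K1_fixed 0 v.
Hypothesis ell_v : ell v = 1.
Hypothesis omega0 : char_conductor omega 0.

(** If W_w vanishes at 1 it vanishes on units, so all unit balls drop out and w is supported on
    p. *)
Lemma spherical_eq0 w : K1_fixed 0 w -> ell w = 0 -> w = 0.
Proof.
move=> wK ew; apply: K1_fixed0_eq0 => //.
have [k [k0 ok vk wk]] := common_level 0 v w omega0.
apply/eqP; rewrite -subr_eq0 -opprB oppr_eq0; apply/eqP.
rewrite (Pr_unit_part k0 (fun x => K1_fixed_nn (x := x) wK)).
apply: big1_seq => r /andP[_]; rewrite mem_filter => /andP[/asboolPn hr /mem_reps hr0].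
have ur := ounitP hr0 hr; have [r0 vr] := ur.
have := Pr_kirillov k0 ok (Pr_bump k0 vk) (etrans (ell_Pr k v) ell_v) r0 wk.
rewrite vr addr0 => ->.
have /eqP := ell_K1 wK ur; rewrite ew normr0 normr_eq0 => /eqP ->.
by rewrite scale0r.
Qed.

Lemma spherical_support y : y != 0 -> ~ pideal 0 y -> ell (aa y v) = 0.
Proof.
move=> y0 hy; have [x hx psx] : exists2 x, pideal 0 x & psi (x * y) != 1.
  by apply: psi_dual; rewrite oppr0.
have := ell_nn (x * y) (aa y v).
rewrite nn_aa// mulfK// (K1_fixed_nn vK hx) => /eqP.
rewrite -subr_eq0 -{1}[ell _]mul1r -mulrBl mulf_eq0 subr_eq0 eq_sym (negPf psx).
by rewrite orFb => /eqP.
Qed.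

Lemma H_bound (u : V) : H u u = H v v -> `|H u v| <= H v v.
Proof.
move=> uv; have v0 : v != 0.
  by apply: contra_eq_neq ell_v => ->; rewrite -(scale0r 0) ellZ mul0r eq_sym oner_eq0.
have h0 : 0 < H v v by rewrite dnorm_gt0.
set h := H v v in h0 uv *; set f := H u v.
have hc : h^* = h by rewrite /h -HC.
have : 0 <= H (h *: u + (- f) *: v) (h *: u + (- f) *: v) by apply: H_ge0.
rewrite !HDl !HDr !HZl !HZr uv -/h -/f (HC v u) -/f hc rmorphN /=.
have -> : h * (h * h) + h * (- f^* * f) + (- f * (h * f^*) + - f * (- f^* * h)) =
   h * (h ^+ 2 - f * f^*) by ring.
rewrite -normCK pmulr_rge0// subr_ge0 => hf.
by rewrite -(@ler_pXn2r _ 2) ?nnegrE ?normr_ge0// ltW.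
Qed.

Lemma sup_spherical g : `|ell (pi g v)| <= 2.
Proof.
have [y [c [y0 hc ->]]] := ell_iwasawa g vK.
rewrite (K1_fixed_lw vK hc).
have [p p0 vp] := exists_val F 1.
have ou u : unit_filtration 0 u -> omega u = 1 by apply: omega0.1.
pose Tv := Uop v p + ww (aa p v).
pose lam := ell Tv.
have wv : ww v = v.
  apply: vK; try exact: pideal0; try exact: pideal1.
    by rewrite mul0r mulr1 sub0r; apply/ounitN/ounit1.
  by rewrite sub0r; apply/pidealN/pideal1.
have TvE : Tv = lam *: v.
  apply/eqP; rewrite -subr_eq0; apply/eqP; apply: spherical_eq0.
    apply: K1_fixedB => //; exact: (Tvec_fixed0 p0 vp vK (leq0n _) ou).
  by rewrite addrC -scaleNr uw_ellL ell_v mulr1 addNr.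
have wwp : ww (aa p v) = omega p *: aa p^-1 v.
  rewrite -{1}wv -act_scalar//; mxact.
have TvE' (t : nat) : lam *: aa (p ^+ t) v =
    \sum_(r <- reps F 0 1) nn (p ^+ t * r) (aa (p ^+ t.+1) v) +
    omega p *: aa (p ^+ t / p) v.
  have pt0 : p ^+ t != 0 by rewrite expf_neq0.
  rewrite -linearZ -TvE /Tv linearD /= wwp linearZ /= aaM ?invr_neq0//.
  congr (_ + _); rewrite /Uop linear_sum; apply: eq_bigr => r _.
  by rewrite /= aa_nn// aaM// exprSr.
have po (t : nat) r : r \in reps F 0 1 -> pideal 0 (p ^+ t * r).
  move=> /mem_reps hr; apply: pidealMl => //.
  elim: t => [|t IH]; first exact: pideal1.
  by rewrite exprS; apply: pidealMl => // _; rewrite vp.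
(* Shifted by one so that [a 0] is the value at p^(-1), which vanishes. *)
pose a (t : nat) := ell (aa (p ^+ t / p) v).
pose f (t : nat) := H (aa (p ^+ t) v) v.
have v0 : v != 0.
  by apply: contra_eq_neq ell_v => ->; rewrite -(scale0r 0) ellZ mul0r eq_sym oner_eq0.
have fr (t : nat) : lam * f t = q%:R * f t.+1 + omega p * H (aa (p ^+ t / p) v) v.
  rewrite /f -HZl TvE' HDl HZl; congr (_ + _).
  rewrite linear_sumlz /=.
  rewrite (eq_big_seq (fun=> f t.+1)).
    by rewrite big_const_seq count_predT size_reps iter_addr_0 expn1 mulr_natl.
  move=> r rs; rewrite -(H_inv (G2 1 (- (p ^+ t * r)) 0 1)) -!/(nn _) nnD addNr nn0.
  by rewrite (K1_fixed_nn vK)//; apply/pidealN/po.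
have key : forall i, `|a i| <= 2.
  apply: (@hecke_recurrence_bound _ q%:R lam (omega p) (H v v) a f).
  - by rewrite ler_nat residue_card_gt1.
  - by rewrite dnorm_gt0.
  - exact: omega_norm.
  - rewrite /a expr0 mul1r spherical_support ?invr_neq0// pidealE ?invr_neq0//.
    by rewrite lf_valV// vp.
  - by rewrite /a expr1 divff// aa1.
  - by rewrite /f expr0 aa1.
  (* By w-invariance the two terms of the recurrence for f at t = 0 involve the same coefficient,
     whence the factor q + 1. *)
  - have e : omega p * H (aa p^-1 v) v = H (aa p v) v.
      have <- : H (ww (aa p v)) (ww v) = H (aa p v) v by exact: H_inv.
      by rewrite wv wwp HZl.
    have := fr 0%N; rewrite /f expr0 mul1r aa1 expr1 e => ->.
    by rewrite mulrDl mul1r.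
  - move=> t; rewrite /a !exprSr !mulfK// -exprSr -ellZ TvE' ellD ellZ.
    congr (_ + _); rewrite (big_morph ell (@ellD _ _ D) (ell0 D)).
    rewrite (eq_big_seq (fun=> ell (aa (p ^+ t.+1) v))).
      by rewrite big_const_seq count_predT size_reps iter_addr_0 expn1 mulr_natl.
    by move=> r rs; rewrite ell_nn psi_o ?mul1r//; apply: po.
  - by move=> t; rewrite fr exprSr mulfK.
  - by move=> t; apply: H_bound; rewrite H_inv.
have [hy|hy] := pselect (pideal 0 y); last first.
  by rewrite spherical_support// normr0 ler0n.
have [t vy] : exists t : nat, lf_val y = t%:Z.
  by case: (lf_val y) (hy y0) => // t _; exists t.
have vpt : lf_val (p ^+ t) = t%:Z.
  elim: (t) => [|i IH]; first by rewrite expr0 lf_val1.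
  by rewrite exprS lf_valM_neq0 ?expf_neq0// IH vp; lia.
have pt0 : p ^+ t != 0 by rewrite expf_neq0.
have uu : ounit (y / p ^+ t).
  split; first by rewrite mulf_neq0 ?invr_neq0.
  by rewrite lf_valM_neq0 ?invr_neq0// lf_valV// vpt vy subrr.
have -> : aa y v = aa (p ^+ t) (aa (y / p ^+ t) v).
  by rewrite aaM ?(proj1 uu)// mulrC divfK.
rewrite (K1_fixed_aa vK uu) linearZ ellZ normrM omega_norm ?mul1r; last by case: uu.
by have := key t.+1; rewrite /a exprSr mulfK.
Qed.

End SphericalVector.

End Spherical.

(** * Translation to the notions of the statement *)

Lemma K1_G2 (F : localField) n (a b c d : F) :
  pideal 0 a -> pideal 0 b -> pideal 0 d -> ounit (a * d - b * c) ->
  pideal n%:Z (a - 1) -> pideal n%:Z c -> K1 n (G2 a b c d).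
Proof.
move=> ha hb hd udet ha1 hc; have det0 : a * d - b * c != 0 by case: udet.
rewrite /K1 /GL2o /= G2E// det_mx2 !mxE /=; split=> //; split=> // i j.
rewrite mxE; do 2!case: ifP => _ //.
by apply: pidealW hc; lia.
Qed.

Lemma K1_entries (F : localField) n (g : GL2 F) : K1 n g -> exists a b c d,
  g = G2 a b c d /\ [/\ pideal 0 a, pideal 0 b, pideal 0 d,
    ounit (a * d - b * c) & pideal n%:Z (a - 1) /\ pideal n%:Z c].
Proof.
have [a [b [c [d [det0 -> gE]]]]] := G2P g.
rewrite /K1 /GL2o /= G2E// det_mx2 !mxE /= => -[[ho udet] ha hc].
exists a, b, c, d; split=> //.
by split=> //; [have := ho 0 0|have := ho 0 1|have := ho 1 1]; rewrite mxE.
Qed.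

Section ComplexModulus.
Variable R : realType.

Lemma normc_normr (z : R[i]) : `|z| = (ComplexField.Normc.normc z)%:C%C.
Proof. by case: z. Qed.

Lemma normc_sqr_le (z : R[i]) (B : R) :
  `|z| ^+ 2 <= B%:C%C -> ComplexField.Normc.normc z ^+ 2 <= B.
Proof. by rewrite normc_normr -rmorphXn lecR. Qed.

Lemma normc_ge0 (z : R[i]) : 0 <= ComplexField.Normc.normc z.
Proof. by rewrite -lecR -normc_normr normr_ge0. Qed.

End ComplexModulus.

Theorem theoremB (R : realType) :
  exists c C : R, [/\ 0 < c, 0 < C &
    forall (F : localField) (psi : F -> R[i])
      (V : lmodType R[i]) (pi : GL2 F -> {linear V -> V})
      (Wh : set (GL2 F -> R[i])) (omega : F -> R[i]) (n m : nat)
      (W : GL2 F -> R[i]),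
      additive_character_conductor_o psi ->
      is_representation pi -> admissible pi -> irreducible_rep pi ->
      unitarizable pi -> generic pi psi ->
      rep_conductor pi n ->
      central_character pi omega -> char_conductor omega m ->
      whittaker_model pi psi Wh -> normalized_newform Wh n W ->
      let q : R := (residue_card F)%:R in
      ((c * Num.max (q `^ (((3 * m) %/ 2)%:R / 2 - n%:R / 2)) 1)%:E
         <= sup_norm W)%E /\
      (sup_norm W <= (C * q `^ ((n %/ 2)%:R / 2))%:E)%E].
Proof.
(* The 2 is the square root of the 4 in [sup_upper] and the bound of [sup_spherical]; 1/2 is below
   1/sqrt 2, the constant that [sup_lower] gives, so the final contradiction is strict. *)
exists 2^-1, 2; split; rewrite ?invr_gt0 ?ltr0n//.
move=> F psi V pi Wh omega n m W psiP piP adm irr [H Hinv] _ [_ nmin] omegaP omP.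
move=> [T [TL Tinj Tpi Tpsi ->]] [[v _ <-] WK W1] q.
pose ell v := T v 1%g.
have ellG g w : ell (pi g w) = T w g by rewrite /ell Tpi mul1g.
have T0 g : T 0 g = 0.
  by have := TL (-1) 0 0 g; rewrite scaler0 addr0 mulN1r addNr.
have ell_inj w : (forall g, ell (pi g w) = 0) -> w = 0.
  move=> hw; apply: Tinj; apply/funext => g.
  by rewrite T0 -ellG.
have ellN x w : ell (pi (unipotent x) w) = psi x * ell w.
  by rewrite ellG -[unipotent x]mulg1 Tpsi.
pose D := @UnitaryWhittaker R F psi V pi omega ell H psiP piP adm irr omegaP
  (fun a u w => TL a u w 1%g) ellN ell_inj Hinv.
have vK : @K1_fixed R F D n v.
  move=> a b c d ha hb hd udet ha1 hc; apply: Tinj; apply/funext => g.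
  by rewrite Tpi WK//; apply: K1_G2.
have new i w : (i < n)%N -> @K1_fixed R F D i w -> w = 0.
  move=> ni wK; have [//|w0] := eqVneq w 0.
  have /nmin : exists2 w : V, w != 0 & fixed_space pi (K1 i) w.
    exists w => // g /K1_entries[a [b [c [d [-> [ha hb hd udet [ha1 hc]]]]]]].
    exact: wK.
  by lia.
have v0 : v != 0.
  by apply: contra_eq_neq W1 => ->; rewrite T0 eq_sym oner_eq0.
have mn : (m <= n)%N.
  by apply: omP.2 => u hu; apply: (K1_fixed_omega vK).
have q1 : 1 < q by rewrite ltr1n residue_card_gt1.
have q0 : 0 < q by apply: lt_trans q1.
have sqrt_sqr (e : R) : (q `^ (e / 2)) ^+ 2 = q `^ e.
  by rewrite -powR_mulrn ?powR_ge0// -powRrM divfK ?pnatr_eq0.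
have nat_pow k : q `^ k%:R = q ^+ k by rewrite powR_mulrn// ltW.
have sup_ge g : ((ComplexField.Normc.normc (T v g))%:E <= sup_norm (T v))%E.
  by apply: ereal_sup_ubound; exists g.
split; last first.
  apply: ub_ereal_sup => _ [g _ <-]; rewrite lee_fin.
  rewrite -(@ler_pXn2r _ 2) ?nnegrE ?normc_ge0 ?mulr_ge0 ?powR_ge0 ?ler0n//.
  rewrite exprMn sqrt_sqr nat_pow; apply: normc_sqr_le.
  rewrite rmorphM !rmorphXn /= !rmorph_nat divn2 -natrX.
  have [n0|n0] := posnP n.
    have m0 : m = 0%N by lia.
    rewrite n0 m0 in vK omP *; rewrite expr0 mulr1 natrX.
    have := @sup_spherical R F D v vK W1 omP g; rewrite /= ellG => h.
    by rewrite ler_pXn2r// nnegrE ?normr_ge0 ?ler0n.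
  have := @sup_upper R F D n m v g n0 mn vK W1 new omP; rewrite /= ellG.
  by [].
set E := _ - _.
have half1 : ((2^-1)%:E <= sup_norm (T v))%E.
  apply: le_trans (sup_ge 1%g); rewrite lee_fin W1.
  by rewrite ComplexField.Normc.normc1 invf_le1 ?ler1n ?ltr0n.
have [E1|E1] := leP (q `^ E) 1; first by rewrite mulr1.
(* If m <= ceil(n/2), then floor(3m/2) <= n, and q^E would be at most 1. *)
have lm : (uphalf n < m)%N.
  rewrite ltnNge; apply/negP => ml; move: E1; rewrite ltNge => /negP; apply.
  rewrite -[leRHS](powRr0 q); apply: ler_powR; first exact: ltW.
  rewrite /E -mulrBl pmulr_lle0 ?invr_gt0 ?ltr0n//.
  by rewrite subr_le0 ler_nat; move: ml; rewrite uphalf_half -divn2; lia.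
have n0 : (0 < n)%N by lia.
rewrite leNgt; apply/negP => hlt.
pose t := 2^-1 * q `^ E.
have t0 : 0 <= t by rewrite mulr_ge0 ?powR_ge0 ?invr_ge0 ?ler0n.
have bnd g : `|@uw_ell R F D (pi g v)| ^+ 2 <= (t ^+ 2)%:C%C.
  rewrite /= ellG normc_normr -rmorphXn lecR.
  rewrite ler_pXn2r ?nnegrE ?normc_ge0// -lee_fin.
  by apply: le_trans (ltW hlt); apply: sup_ge.
have := @sup_lower R F D n m v _ n0 mn vK W1 omP lm bnd.
have -> : (residue_card F)%:R = q%:C%C :> R[i] by rewrite rmorph_nat.
rewrite -rmorphMn -rmorphXn lecR.
rewrite leNgt => /negP; apply.
have -> : t ^+ 2 *+ 2 = 2^-1 * q `^ (((3 * m) %/ 2)%:R - n%:R).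
  by rewrite /t exprMn /E -mulrBl sqrt_sqr; field.
rewrite -nat_pow.
have : q `^ (((3 * m) %/ 2)%:R - n%:R) <= q `^ (m - uphalf n)%:R.
  apply: ler_powR; first exact: ltW.
  rewrite lerBlDr -natrD ler_nat.
  by move: lm; rewrite uphalf_half -divn2; lia.
have := powR_gt0 (m - uphalf n)%:R q0; lra.
Qed.
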